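(* Let $\mathcal P$ be a good grid of a finite measure space $(I,\mathbb A,m)$, $p\in[1,\infty)$, $q,\tilde q\in[1,\infty]$, $0<s<1/p$ and $\beta>s$. There is a constant $C$ with the following property. Let $g_i\in\mathcal B^{\beta,t_i}_{p,\tilde q,selfs}$, with $i\in\Lambda\subset\mathbb N$ and $t_i\in\mathbb N$. Consider a function $f$ with a $\mathcal B^s_{p,q}$-representation $$f=\sum_k\sum_{Q\in\mathcal P^k}c_Qa_Q$$ satisfying: A. $\displaystyle\sup_{Q\in\mathcal P,\ c_Q\ne0}\ \ \sum_{i:\ Q\cap\operatorname{supp}g_i\ne\emptyset}|g_i|_{\mathcal B^{\beta,t_i}_{p,\tilde q,selfs}}\le N.$ B. If $Q\in\mathcal P^k$ satisfies $c_Q\ne0$ and $Q\cap\operatorname{supp}g_i\ne\emptyset$, then $k\ge t_i$. Then we can find a $\mathcal B^s_{p,q}$-representation $$\Big(\sum_ig_i\Big)f=\sum_k\sum_{Q\in\mathcal P^k}d_Qa_Q$$ such that $$\Big(\sum_k\big(\sum_{Q\in\mathcal P^k}|d_Q|^p\big)^{q/p}\Big)^{1/q}\le C\,N\,\Big(\sum_k\big(\sum_{Q\in\mathcal P^k}|c_Q|^p\big)^{q/p}\Big)^{1/q}.$$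
   Context: $|J|=m(J)$; $\mathbb N=\{0,1,\dots\}$; sup modification when an exponent is $\infty$. $\operatorname{supp}g=\{x:g(x)\ne0\}$. When $\Lambda$ is infinite, $(\sum_ig_i)f$ is understood as $\sum_i g_if$. In both representations $a_Q$ denotes an $(s,p)$-Souza's atom on $Q$ (which may be taken canonical, $a_Q=|Q|^{s-1/p}1_Q$). Good grid: for some $0<\lambda_1<\lambda_2<1$, a sequence $\mathcal P=(\mathcal P^k)_{k\in\mathbb N}$ of finite families of measurable sets of positive measure with: $\mathcal P^0=\{I\}$; $I=\bigcup_{Q\in\mathcal P^k}Q$ up to a null set; the elements of $\mathcal P^k$ are pairwise disjoint; every $Q\in\mathcal P^k$, $k>0$, is contained in some $P\in\mathcal P^{k-1}$; $\lambda_1\le|Q|/|P|\le\lambda_2$ whenever $Q\subset P$, $Q\in\mathcal P^{k+1}$, $P\in\mathcal P^k$; $\bigcup_k\mathcal P^k$ generates $\mathbb A$. Also $\mathcal P$ denotes $\bigcup_k\mathcal P^k$. For any $s>0$: an $(s,p)$-Souza's atom on $Q\in\mathcal P$ is a function constant on $Q$, zero outside $Q$, with sup norm $\le|Q|^{s-1/p}$; their set is $\mathcal A^{sz}_{s,p}(Q)$. A $\mathcal B^s_{p,q}$-representation of $g\in L^p$ is $g=\sum_k\sum_{Q\in\mathcal P^k}s_Qa_Q$ with $a_Q\in\mathcal A^{sz}_{s,p}(Q)$, $s_Q\in\mathbb C$, $\sum_k|\sum_{Q\in\mathcal P^k}s_Qa_Q|_p<\infty$ and finite cost $(\sum_k(\sum_{Q\in\mathcal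 P^k}|s_Q|^p)^{q/p})^{1/q}$; $\mathcal B^s_{p,q}$ is the set of $g$ having one, and $|g|_{\mathcal B^s_{p,q}}$ is the infimum of the costs. For $t\in\mathbb N$, $\mathcal B^{\beta,t}_{p,\tilde q,selfs}$ is the set of $g\in\mathcal B^\beta_{p,\tilde q}$ with $$|g|_{\mathcal B^{\beta,t}_{p,\tilde q,selfs}}:=\sup\{|ga_Q|_{\mathcal B^\beta_{p,\tilde q}}:\ a_Q\in\mathcal A^{sz}_{\beta,p}(Q),\ Q\in\mathcal P^j,\ j\ge t\}<\infty.$$ *)

(* Defs.v *)
From HB Require Import structures.
From mathcomp Require Export all_boot all_order all_algebra.
From mathcomp Require Export complex.
From mathcomp Require Export all_classical all_reals all_analysis.
Export Order.TTheory GRing.Theory Num.Theory.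
Export numFieldNormedType.Exports.

Set Implicit Arguments.
Unset Strict Implicit.
Unset Printing Implicit Defensive.

Local Open Scope classical_set_scope.
Local Open Scope ring_scope.

(* The ambient set I is the whole type T.  Functions are honest functions
   T -> R[i] (not classes), so that [supp] below makes sense; equality of
   functions in L^p is expressed through the L^p seminorm.
   [normc] is the R-valued modulus ([`|z|] lives in R[i]). *)
Definition normc (R : realType) (z : R[i]) : R := Normc.normc z.

Definition measurable_complex (R : realType) (d : measure_display)
    (T : measurableType d) (g : T -> R[i]) : Prop :=
  measurable_fun setT (fun x => complex.Re (g x)) /\
  measurable_fun setT (fun x => complex.Im (g x)).

Definition LpNorm (R : realType) (d : measure_display) (T : measurableType d)
    (m : {measure set T -> \bar R}) (p : R) (g : T -> R[i]) : \bar R :=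
  Lnorm m p%:E (fun x => (normc (g x))%:E).

Definition Lp (R : realType) (d : measure_display) (T : measurableType d)
    (m : {measure set T -> \bar R}) (p : R) (g : T -> R[i]) : Prop :=
  measurable_complex g /\ (LpNorm m p g < +oo)%E.

Definition Lp_cvg (R : realType) (d : measure_display) (T : measurableType d)
    (m : {measure set T -> \bar R}) (p : R) (u : nat -> T -> R[i])
    (g : T -> R[i]) : Prop :=
  (fun n => LpNorm m p (fun x => g x - u n x)) @ \oo --> 0%E.

Definition supp (R : realType) (T : Type) (g : T -> R[i]) : set T :=
  [set x | g x != 0].

(* |Q|, as a real number *)
Definition vol (R : realType) (d : measure_display) (T : measurableType d)
    (m : {measure set T -> \bar R}) (Q : set T) : R := fine (m Q).

Record good_grid (R : realType) (d : measure_display) (T : measurableType d)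
    (m : {measure set T -> \bar R}) (P : nat -> set (set T)) : Prop := GoodGrid {
  grid_finite : forall k, finite_set (P k) ;
  grid_measurable : forall k Q, P k Q -> measurable Q ;
  grid_pos : forall k Q, P k Q -> (0 < m Q)%E ;
  grid_0 : P 0%N = [set setT] ;
  grid_cover : forall k, m (~` \bigcup_(Q in P k) Q) = 0%E ;
  grid_disjoint : forall k, trivIset (P k) id ;
  grid_nested : forall k Q, P k.+1 Q -> exists2 Q', P k Q' & Q `<=` Q' ;
  grid_ratio : exists l1 l2 : R, [/\ 0 < l1, l1 < l2, l2 < 1 &
    forall k Q Q', P k.+1 Q -> P k Q' -> Q `<=` Q' ->
      l1 <= vol m Q / vol m Q' <= l2] ;
  grid_generates : <<s \bigcup_k P k >> = @measurable d T
}.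

Definition souza_atom (R : realType) (d : measure_display)
    (T : measurableType d) (m : {measure set T -> \bar R}) (s p : R)
    (Q : set T) (a : T -> R[i]) : Prop :=
  [/\ exists z, forall x, Q x -> a x = z,
      forall x, ~ Q x -> a x = 0 &
      forall x, normc (a x) <= vol m Q `^ (s - p^-1)].

Definition canonical_atom (R : realType) (d : measure_display)
    (T : measurableType d) (m : {measure set T -> \bar R}) (s p : R)
    (Q : set T) : T -> R[i] :=
  fun x => ((vol m Q `^ (s - p^-1)) * \1_Q x)%:C%C.

(* Coefficients and atoms are indexed by the sets Q themselves: in a good grid
   the levels are pairwise disjoint, so Q determines its level.  Values off the
   grid are irrelevant. *)
Definition level_sum (R : realType) (T : Type) (P : nat -> set (set T))
    (c : set T -> R[i]) (a : set T -> T -> R[i]) (k : nat) : T -> R[i] :=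
  fun x => \sum_(Q \in P k) c Q * a Q x.

(* The exponent q is meant in [1, +oo]; the value -oo does not occur. *)
Definition cost (R : realType) (T : Type) (P : nat -> set (set T)) (p : R)
    (q : \bar R) (c : set T -> R[i]) : \bar R :=
  let u k : R := \sum_(Q \in P k) normc (c Q) `^ p in
  match q with
  | r%:E => ((\sum_(0 <= k <oo) (u k `^ (r / p))%:E) `^ r^-1)%E
  | _ => ereal_sup (range (fun k => (u k `^ p^-1)%:E))
  end.

Record representation (R : realType) (d : measure_display)
    (T : measurableType d) (m : {measure set T -> \bar R})
    (P : nat -> set (set T)) (s p : R) (q : \bar R) (g : T -> R[i])
    (c : set T -> R[i]) (a : set T -> T -> R[i]) : Prop := Representation {
  repr_Lp : Lp m p g ;
  repr_atom : forall k Q, P k Q -> souza_atom m s p Q (a Q) ;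
  repr_abs_cvg : (\sum_(0 <= k <oo) LpNorm m p (level_sum P c a k) < +oo)%E ;
  repr_sum : Lp_cvg m p (fun n x => \sum_(0 <= k < n) level_sum P c a k x) g ;
  repr_cost : (cost P p q c < +oo)%E
}.

Definition besov (R : realType) (d : measure_display)
    (T : measurableType d) (m : {measure set T -> \bar R})
    (P : nat -> set (set T)) (s p : R) (q : \bar R) (g : T -> R[i]) : Prop :=
  exists c a, representation m P s p q g c a.

(* Equal to +oo when g has no representation. *)
Definition besov_norm (R : realType) (d : measure_display)
    (T : measurableType d) (m : {measure set T -> \bar R})
    (P : nat -> set (set T)) (s p : R) (q : \bar R) (g : T -> R[i]) : \bar R :=
  ereal_inf [set v | exists c a,
    representation m P s p q g c a /\ v = cost P p q c].

Definition selfs_norm (R : realType) (d : measure_display)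
    (T : measurableType d) (m : {measure set T -> \bar R})
    (P : nat -> set (set T)) (beta p : R) (q : \bar R) (t : nat)
    (g : T -> R[i]) : \bar R :=
  ereal_sup [set v | exists j Q a,
    [/\ (t <= j)%N, P j Q, souza_atom m beta p Q a &
        v = besov_norm m P beta p q (fun x => g x * a x)]].

Definition selfs (R : realType) (d : measure_display)
    (T : measurableType d) (m : {measure set T -> \bar R})
    (P : nat -> set (set T)) (beta p : R) (q : \bar R) (t : nat)
    (g : T -> R[i]) : Prop :=
  besov m P beta p q g /\ (selfs_norm m P beta p q t g < +oo)%E.

(* h = (sum_(i in Lambda) g_i) f, understood as the L^p limit of the partial
   sums of the g_i f.  When Lambda is finite these are eventually constant and
   this says that h is almost everywhere the ordinary (finite sum) times f. *)
Definition is_sum_times (R : realType) (d : measure_display)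
    (T : measurableType d) (m : {measure set T -> \bar R}) (p : R)
    (Lambda : set nat) (g : nat -> T -> R[i]) (f h : T -> R[i]) : Prop :=
  Lp_cvg m p (fun n x => \sum_(0 <= i < n | i \in Lambda) g i x * f x) h.

(* Main.v *)
(* Multiplying f = sum_Q c_Q a_Q by g = sum_i g_i amounts to expanding each
   product g_i b_Q, where b_Q is the canonical (beta,p)-atom of Q.  The key
   point is that, whatever beta > 0, this product has an expansion supported on
   the cells W contained in Q, each level of which has l^p norm at most a
   constant times |g_i|_selfs.  Indeed, in any representation of g_i b_Q the
   cells strictly containing Q contribute a constant on the parent of Q; since
   g_i b_Q vanishes on the parent outside Q, that constant is controlled by the
   fine part of the representation, so it can be absorbed in the coefficient
   of Q itself.

   Rewriting the (beta,p)-atom of W as an (s,p)-atom and a_Q as a multiple of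
   b_Q produces the factor (|W|/|Q|)^(beta-s) <= th^(j-k), th = l2^(beta-s) < 1,
   for W in P^j inside Q in P^k.  Summing over i by hypothesis A and over the
   ancestors Q of W, the level norms of the new coefficients are bounded by
   C N times the convolution of the level norms of c with th^l, and Young's
   inequality bounds the cost.  The absolute convergence of all the series
   involved, geometric in the level j, identifies the sum in L^p. *)
Require Import Defs.
From mathcomp Require Import ring lra measurable_realfun.

Set Implicit Arguments.
Unset Strict Implicit.
Unset Printing Implicit Defensive.

Local Open Scope classical_set_scope.
Local Open Scope ring_scope.

(** * Finite l^p norms *)

(** Instead, [f] minus a partial sum is bounded almost everywhere by the series of the moduli of the
    remaining levels, and this bound is multiplied by [g] pointwise, before norms are taken.
    Hypothesis A is local: it controls the [g_i] that meet one cell, while the norms of all the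
    [g_i] may sum to infinity. So the sum over i is taken inside the coefficient of each pair (Q,
    W), where it converges absolutely. The limit function is built from these coefficients; the
    partial sums over i are then compared with it by cutting at a level J beyond which all tails are
    small, uniformly in the number of terms. The selfs norm involves infima that need not be
    attained. This costs a factor 2, and norm zero is a separate case, where the product is null
    almost everywhere. From the cost of each product only the uniform bound of its level norms is
    kept; the decay th^l restores summability over the levels. *)

Section modulus.
Context {R : realType}.
Implicit Types z w : R[i].

Lemma normc_ge0 z : 0 <= normc z.
Proof. by case: z => a b; exact: sqrtr_ge0. Qed.

Lemma normcM z w : normc (z * w) = normc z * normc w.
Proof. exact: Normc.normcM. Qed.

Lemma normc0 : normc (0 : R[i]) = 0.
Proof. exact: Normc.normc0. Qed.

Lemma normc_eq0 z : (normc z == 0) = (z == 0).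
Proof.
by apply/eqP/eqP => [/Normc.eq0_normc//|->]; exact: normc0.
Qed.

Lemma normcD z w : normc (z + w) <= normc z + normc w.
Proof. exact: le_normcD. Qed.

Lemma normcN z : normc (- z) = normc z.
Proof. exact: normcN. Qed.

Lemma normc_real (x : R) : normc (x%:C)%C = `|x|.
Proof. by rewrite /normc/= expr0n/= addr0 sqrtr_sqr. Qed.

Lemma normc_sum (I : Type) (r : seq I) (Q : pred I) (F : I -> R[i]) :
  normc (\sum_(i <- r | Q i) F i) <= \sum_(i <- r | Q i) normc (F i).
Proof.
elim/big_rec2 : _ => [|i y x _ xy]; first by rewrite normc0.
by rewrite (le_trans (normcD _ _))// lerD2l.
Qed.

Lemma normc_Re z : `|complex.Re z| <= normc z.
Proof.
case: z => a b; rewrite /normc/= -sqrtr_sqr ler_sqrt ?addr_ge0 ?sqr_ge0//.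
by rewrite lerDl sqr_ge0.
Qed.

Lemma normc_Im z : `|complex.Im z| <= normc z.
Proof.
case: z => a b; rewrite /normc/= -sqrtr_sqr ler_sqrt ?addr_ge0 ?sqr_ge0//.
by rewrite lerDr sqr_ge0.
Qed.

Lemma normc_le_ReIm z : normc z <= `|complex.Re z| + `|complex.Im z|.
Proof.
case: z => a b /=.
rewrite -[leRHS]ger0_norm ?addr_ge0// -sqrtr_sqr ler_sqrt ?sqr_ge0//.
rewrite sqrrD !real_normK ?num_real//.
by rewrite addrAC lerDl mulrn_wge0// mulr_ge0.
Qed.

Lemma ReD z w : complex.Re (z + w) = complex.Re z + complex.Re w.
Proof. by case: z w => [a b] [c d]. Qed.

Lemma ImD z w : complex.Im (z + w) = complex.Im z + complex.Im w.
Proof. by case: z w => [a b] [c d]. Qed.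

Lemma Re_sum (I : Type) (r : seq I) (Q : pred I) (F : I -> R[i]) :
  complex.Re (\sum_(i <- r | Q i) F i) = \sum_(i <- r | Q i) complex.Re (F i).
Proof. by apply: big_morph => [z w|]; [exact: ReD|]. Qed.

Lemma Im_sum (I : Type) (r : seq I) (Q : pred I) (F : I -> R[i]) :
  complex.Im (\sum_(i <- r | Q i) F i) = \sum_(i <- r | Q i) complex.Im (F i).
Proof. by apply: big_morph => [z w|]; [exact: ImD|]. Qed.

End modulus.

Section finite_lp.
Context {R : realType}.
Implicit Types (p : R).

Lemma powR_exprn (a b : R) n : 0 <= a -> (a ^+ n) `^ b = (a `^ b) ^+ n.
Proof.
by move=> a0; rewrite -powR_mulrn// -powRrM mulrC powRrM powR_mulrn// powR_ge0.
Qed.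

Definition lpn (I : Type) (r : seq I) p (x : I -> R) : R :=
  (\sum_(i <- r) x i `^ p) `^ p^-1.

Lemma lpn_ge0 (I : Type) (r : seq I) p (x : I -> R) : 0 <= lpn r p x.
Proof. exact: powR_ge0. Qed.

Lemma sum_powR_ge0 (I : Type) (r : seq I) p (x : I -> R) :
  0 <= \sum_(i <- r) x i `^ p.
Proof. by apply: sumr_ge0 => i _; exact: powR_ge0. Qed.

Lemma lpn_powR (I : Type) (r : seq I) p (x : I -> R) : 0 < p ->
  lpn r p x `^ p = \sum_(i <- r) x i `^ p.
Proof.
by move=> p0; rewrite /lpn -powRrM mulVf ?gt_eqF// powRr1// sum_powR_ge0.
Qed.

Lemma le_lpn_sum (I : Type) (r : seq I) p (x : I -> R) (B : R) :
  0 < p -> 0 <= B -> \sum_(i <- r) x i `^ p <= B `^ p -> lpn r p x <= B.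
Proof.
move=> p0 B0 xB.
rewrite -(powRr1 B0) -(mulfV (lt0r_neq0 p0)) powRrM.
by rewrite /lpn ge0_ler_powR ?invr_ge0 ?nnegrE ?powR_ge0 ?sum_powR_ge0// ltW.
Qed.

Lemma le_lpn (I : eqType) (r : seq I) p (x y : I -> R) : 0 < p ->
  (forall i, i \in r -> 0 <= x i <= y i) -> lpn r p x <= lpn r p y.
Proof.
move=> p0 xy; apply: le_lpn_sum => //; first exact: lpn_ge0.
rewrite lpn_powR// !big_seq; apply: ler_sum => i /xy /andP[x0 xyi].
by apply: ge0_ler_powR => //; rewrite ?nnegrE ?(ltW p0)// (le_trans x0).
Qed.

Lemma eq_lpn (I : eqType) (r : seq I) p (x y : I -> R) :
  (forall i, i \in r -> x i = y i) -> lpn r p x = lpn r p y.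
Proof. by move=> xy; congr (_ `^ _); apply: eq_big_seq => i /xy ->. Qed.

Lemma lpn0 (I : Type) (r : seq I) p : 0 < p -> lpn r p (fun=> 0) = 0.
Proof.
by move=> p0; rewrite /lpn big1 => [|i _]; rewrite powR0 ?invr_neq0 ?gt_eqF.
Qed.

Lemma lpnZ (I : eqType) (r : seq I) p k (x : I -> R) :
  0 < p -> 0 <= k -> (forall i, i \in r -> 0 <= x i) ->
  lpn r p (fun i => k * x i) = k * lpn r p x.
Proof.
move=> p0 k0 x0; rewrite /lpn.
under eq_big_seq => i ir do rewrite powRM// ?x0//.
rewrite -mulr_sumr powRM ?powR_ge0 ?sum_powR_ge0//.
by rewrite -powRrM mulfV ?gt_eqF// powRr1.
Qed.

Lemma coord_le_lpn (I : eqType) (r : seq I) p (x : I -> R) i : 0 < p ->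
  i \in r -> 0 <= x i -> x i <= lpn r p x.
Proof.
move=> p0 ir x0.
rewrite -(powRr1 x0) -(mulfV (lt0r_neq0 p0)) powRrM /lpn.
rewrite ge0_ler_powR ?invr_ge0 ?nnegrE ?powR_ge0 ?sum_powR_ge0 ?(ltW p0)//.
by rewrite (perm_big _ (perm_to_rem ir)) big_cons lerDl sum_powR_ge0.
Qed.

Lemma lpn_eq0 (I : eqType) (r : seq I) p (x : I -> R) : 0 < p ->
  (forall i, i \in r -> 0 <= x i) -> lpn r p x = 0 ->
  forall i, i \in r -> x i = 0.
Proof.
move=> p0 x0 x00 i ir; apply/eqP; rewrite eq_le x0// andbT -x00.
by apply: coord_le_lpn => //; exact: x0.
Qed.

(** Division by the norms A and B reduces the triangle inequality to convexity of t^p with weights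
    A/(A+B) and B/(A+B). Vanishing norms are settled first, as they cannot be divided by. *)
Lemma lpnD (I : eqType) (r : seq I) p (x y : I -> R) : 1 <= p ->
  (forall i, i \in r -> 0 <= x i) -> (forall i, i \in r -> 0 <= y i) ->
  lpn r p (fun i => x i + y i) <= lpn r p x + lpn r p y.
Proof.
move=> p1 x0 y0; have p0 : 0 < p by exact: lt_le_trans p1.
have [A0|A0] := eqVneq (lpn r p x) 0.
  rewrite A0 add0r (@eq_lpn _ _ _ _ y)// => i ir.
  by rewrite (lpn_eq0 p0 x0 A0 ir) add0r.
have [B0|B0] := eqVneq (lpn r p y) 0.
  rewrite B0 addr0 (@eq_lpn _ _ _ _ x)// => i ir.
  by rewrite (lpn_eq0 p0 y0 B0 ir) addr0.
have {}A0 : 0 < lpn r p x by rewrite lt0r A0 lpn_ge0.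
have {}B0 : 0 < lpn r p y by rewrite lt0r B0 lpn_ge0.
move EA : (lpn r p x) => A in A0 *; move EB : (lpn r p y) => B in B0 *.
have AB0 : 0 < A + B by rewrite addr_gt0.
apply: le_lpn_sum => //; first exact: ltW.
have tP : 0 <= A / (A + B) <= 1.
  apply/andP; split; first by rewrite divr_ge0// ltW.
  by rewrite ler_pdivrMr// mul1r lerDl ltW.
have onemt : 1 - A / (A + B) = B / (A + B).
  by rewrite -[1](@divff _ (A + B)) ?gt_eqF// -mulrBl addrAC subrr add0r.
have key i : i \in r -> (x i + y i) `^ p <= (A + B) `^ p *
   (A / (A + B) * (x i / A) `^ p + B / (A + B) * (y i / B) `^ p).
  move=> ir; have xi0 := x0 _ ir; have yi0 := y0 _ ir.
  pose t := Itv01 (proj1 (andP tP)) (proj2 (andP tP)).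
  have xA : 0 <= x i / A by rewrite divr_ge0 // ltW.
  have yB : 0 <= y i / B by rewrite divr_ge0 // ltW.
  have H : (A / (A + B) * (x i / A) + B / (A + B) * (y i / B)) `^ p <=
      A / (A + B) * (x i / A) `^ p + B / (A + B) * (y i / B) `^ p.
    rewrite -onemt; apply: (@convex_powR R p p1 t (x i / A) (y i / B));
    by rewrite inE/= in_itv/= andbT.
  have -> : x i + y i = (A + B) * (A / (A + B) * (x i / A) + B / (A + B) * (y i / B)).
    by field; rewrite !gt_eqF.
  have B1 : 0 <= B / (A + B) by rewrite divr_ge0 ?ltW.
  rewrite powRM ?(ltW AB0)//; first by rewrite ler_wpM2l// powR_ge0.
  by rewrite addr_ge0// mulr_ge0// divr_ge0 ?ltW.
rewrite big_seq (le_trans (ler_sum _ key))// -big_seq -mulr_sumr.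
rewrite -[leRHS]mulr1 ler_wpM2l ?powR_ge0// big_split/= -!mulr_sumr.
suff N1 (z : I -> R) (C : R) : 0 < C -> (forall i, i \in r -> 0 <= z i) ->
    lpn r p z = C -> \sum_(i <- r) (z i / C) `^ p = 1.
  by rewrite (N1 x A)// (N1 y B)// !mulr1 -mulrDl divff ?gt_eqF.
move=> C0 z0 zC.
under eq_big_seq => i ir do rewrite powRM ?invr_ge0 ?z0 ?(ltW C0)//.
rewrite -mulr_suml -lpn_powR// zC -powRM ?invr_ge0 ?(ltW C0)// divff ?gt_eqF//.
by rewrite powR1.
Qed.

Lemma lpn_sum (I : eqType) (J : Type) (r : seq I) (t : seq J) p
    (x : J -> I -> R) : 1 <= p -> (forall j i, i \in r -> 0 <= x j i) ->
  lpn r p (fun i => \sum_(j <- t) x j i) <= \sum_(j <- t) lpn r p (x j).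
Proof.
move=> p1 x0; elim: t => [|j t IH].
  rewrite big_nil (@eq_lpn _ _ _ _ (fun=> 0)) ?lpn0 ?(lt_le_trans _ p1)//.
  by move=> i _; rewrite big_nil.
rewrite big_cons (le_trans _ (lerD (lexx _) IH))//.
rewrite (@eq_lpn _ _ _ _ (fun i => x j i + \sum_(j <- t) x j i)); last first.
  by move=> i _; rewrite big_cons.
by apply: lpnD => // i ir; [exact: x0|apply: sumr_ge0 => k _; exact: x0].
Qed.

(** Meant for the disjoint cells of one level: a point lies in at most one of them, and so does a
    smaller cell. Taking p-th powers inside such a sum loses no constant. *)
Lemma powR_sum_single (I : eqType) (r : seq I) p (x : I -> R) : 0 < p ->
  uniq r ->
  (forall i j, i \in r -> j \in r -> x i != 0 -> x j != 0 -> i = j) ->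
  (\sum_(i <- r) x i) `^ p = \sum_(i <- r) x i `^ p.
Proof.
move=> p0 ur single.
have [/hasP[i ir xi0]|/hasPn r0] := boolP (has (fun i => x i != 0) r).
  have z j : j \in r -> j != i -> x j = 0.
    by move=> jr ji; apply/eqP/negPn/negP => xj0; rewrite (single _ _ jr ir xj0 xi0) eqxx in ji.
  rewrite [in LHS](bigD1_seq i)//= [in RHS](bigD1_seq i)//=.
  rewrite [X in _ + X]big_seq_cond [X in _ + X]big1 ?addr0; last first.
    by move=> j /andP[jr ji]; rewrite z.
  rewrite [X in _ + X]big_seq_cond [X in _ + X]big1 ?addr0// => j /andP[jr ji].
  by rewrite z// powR0// gt_eqF.
rewrite 2!big_seq big1 ?powR0 ?gt_eqF//; last by move=> i /r0 /negPn/eqP.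
by rewrite big1// => i /r0 /negPn/eqP ->; rewrite powR0// gt_eqF.
Qed.

Lemma lpn_cvg0 (I : eqType) (r : seq I) p (x : nat -> I -> R) : 0 < p ->
  (forall n i, 0 <= x n i) -> (forall i, i \in r -> x^~ i @ \oo --> 0) ->
  (fun n => lpn r p (x n)) @ \oo --> 0.
Proof.
move=> p0 x0 xcvg.
have unif e : 0 < e -> \forall n \near \oo, forall i, i \in r -> x n i <= e.
  move=> e0; elim: r xcvg => [|i r IH] xcvg.
    by apply: nearW => n i; rewrite in_nil.
  have h1 : \forall n \near \oo, x n i <= e.
    have /cvgrPdist_le/(_ e e0) := xcvg i (mem_head _ _).
    by apply: filterS => n; rewrite sub0r normrN ger0_norm.
  have h2 := IH (fun j jr => xcvg j (@mem_behead _ (i :: r) j jr)).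
  apply: filterS2 h1 h2 => n xi xr j.
  by rewrite inE => /predU1P[->//|/xr].
(* The summand 1 keeps the divisor positive when [r] is empty. *)
have K0 : 0 < 1 + lpn r p (fun=> 1) by rewrite ltr_pwDl// lpn_ge0.
apply/cvgrPdist_le => e e0.
apply: filterS (unif (e / (1 + lpn r p (fun=> 1))) (divr_gt0 e0 K0)) => n xe.
rewrite sub0r normrN ger0_norm ?lpn_ge0//.
set b := e / _ in xe; have b0 : 0 <= b by rewrite divr_ge0// ltW.
apply: (@le_trans _ _ (lpn r p (fun=> b * 1))).
  by apply: le_lpn => // i ir; rewrite x0 mulr1 xe.
rewrite lpnZ// /b -mulrA ger_pMr// ler_pdivrMl// mulr1.
by rewrite lerDr.
Qed.

Lemma sum_expr_le (n : nat) (t : R) : 0 <= t -> t < 1 ->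
  \sum_(i < n) t ^+ i <= (1 - t)^-1.
Proof.
move=> t0 t1; have t10 : 0 < 1 - t by rewrite subr_gt0.
rewrite -[leRHS]mul1r ler_pdivlMr// mulrC.
have := @subrX1 R t n; rewrite -opprB -[t - 1]opprB mulNr => /oppr_inj <-.
by rewrite gerDl oppr_le0 exprn_ge0.
Qed.

End finite_lp.

(** * Mixed costs *)

Section mixed_cost.
Context {R : realType}.
Implicit Types (x y : nat -> R) (q : \bar R).

(** The outer norm of [cost], separated from the inner one. The catch-all branch mirrors that of
    [cost], so that the two agree for every [q]. *)
Definition lqcost q x : \bar R :=
  match q with
  | r%:E => ((\sum_(0 <= k <oo) (x k `^ r)%:E) `^ r^-1)%E
  | _ => ereal_sup (range (fun k => (x k)%:E))
  end.

Lemma lqcost_ge0 q x : (forall k, 0 <= x k) -> (0 <= lqcost q x)%E.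
Proof.
move=> x0; case: q => [r||] /=; first exact: poweR_ge0.
- by apply: le_trans (ereal_sup_ubound _); [|exists 0%N; reflexivity]; rewrite lee_fin.
- by apply: le_trans (ereal_sup_ubound _); [|exists 0%N; reflexivity]; rewrite lee_fin.
Qed.

Lemma lpn_le_lqcost (r : R) x J : 0 < r ->
  ((lpn (index_iota 0 J) r x)%:E <= lqcost r%:E x)%E.
Proof.
move=> r0; rewrite /lqcost /lpn -poweR_EFin.
rewrite gt0_ler_poweR ?invr_ge0 ?(ltW r0)// ?in_itv/= ?leey ?andbT//.
- by rewrite lee_fin sumr_ge0// => k _; exact: powR_ge0.
- by apply: nneseries_ge0 => k _ _; rewrite lee_fin powR_ge0.
- rewrite -sumEFin; apply: nneseries_lim_ge => k _ _.
  by rewrite lee_fin powR_ge0.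
Qed.

Lemma level_le_lqcost q x k : (1 <= q)%E -> (forall k, 0 <= x k) ->
  ((x k)%:E <= lqcost q x)%E.
Proof.
case: q => [r||] //= q1 x0; last by apply: ereal_sup_ubound; exists k.
have r0 : 0 < r by rewrite (lt_le_trans ltr01).
apply: le_trans (lpn_le_lqcost x k.+1 r0); rewrite lee_fin.
by apply: coord_le_lpn => //; rewrite mem_index_iota/=.
Qed.

Lemma lqcost_le q x (B : R) : (1 <= q)%E -> 0 <= B ->
  (forall k, 0 <= x k) ->
  (forall r, q = r%:E -> forall J, lpn (index_iota 0 J) r x <= B) ->
  (q = +oo%E -> forall k, x k <= B) -> (lqcost q x <= B%:E)%E.
Proof.
case: q => [r||] //= q1 B0 x0 Hr Hy; last first.
  by apply: ge_ereal_sup => _ [k _ <-]; rewrite lee_fin Hy.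
have r0 : 0 < r by rewrite (lt_le_trans ltr01).
suff H : (\sum_(0 <= k <oo) (x k `^ r)%:E <= (B `^ r)%:E)%E.
  have <- : ((B `^ r)%:E `^ r^-1 = B%:E)%E.
    by rewrite poweR_EFin -powRrM mulfV ?gt_eqF// powRr1.
  rewrite gt0_ler_poweR ?invr_ge0 ?(ltW r0)// ?in_itv/= ?leey ?andbT//.
  - by apply: nneseries_ge0 => k _ _; rewrite lee_fin powR_ge0.
  - by rewrite lee_fin powR_ge0.
apply: lime_le.
  by apply: is_cvg_nneseries => k _ _; rewrite lee_fin powR_ge0.
apply: nearW => J; rewrite sumEFin lee_fin -lpn_powR//.
by rewrite ge0_ler_powR ?nnegrE ?lpn_ge0 ?(ltW r0) ?(Hr r).
Qed.

(* Minkowski in the form y = K * sum_l th^l (x shifted by l). *)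
Lemma lqcost_conv q x y (K th : R) : (1 <= q)%E -> 0 <= K ->
  0 <= th -> th < 1 -> (forall k, 0 <= x k) -> (forall k, 0 <= y k) ->
  (lqcost q x < +oo)%E ->
  (forall j, y j <= K * \sum_(l < j.+1) th ^+ l * x (j - l)%N) ->
  (lqcost q y <= (K / (1 - th))%:E * lqcost q x)%E.
Proof.
move=> q1 K0 th0 th1 x0 y0 xfin yx.
have Xfin : lqcost q x \is a fin_num by rewrite ge0_fin_numE// lqcost_ge0.
set X := fine (lqcost q x).
have X0 : 0 <= X by rewrite fine_ge0// lqcost_ge0.
have EX : lqcost q x = X%:E by rewrite fineK.
have iK : 0 <= K / (1 - th) by rewrite divr_ge0// subr_ge0 ltW.
have bnd J (F : nat -> R) : (forall l, F l <= X) ->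
    K * \sum_(l < J) th ^+ l * F l <= K / (1 - th) * X.
  move=> FX; rewrite -mulrA ler_wpM2l//.
  apply: (@le_trans _ _ (\sum_(l < J) th ^+ l * X)).
    by apply: ler_sum => l _; rewrite ler_wpM2l// exprn_ge0.
  by rewrite -mulr_suml ler_wpM2r// sum_expr_le.
rewrite EX -EFinM; apply: lqcost_le => //; first by rewrite mulr_ge0.
- move=> r qr J; subst q; have r1 : 1 <= r by rewrite -lee_fin.
  have r0 : 0 < r by rewrite (lt_le_trans ltr01).
  (* The shift of [x] by [l], padded with zeros. The padding lets all the sums over [l < j.+1] run
     over the common range [l < J], so that the triangle inequality applies, and a shift does not
     increase the norm. *)
  pose sh l j : R := if (l <= j)%N then x (j - l)%N else 0.
  have sh0 l j : 0 <= sh l j by rewrite /sh; case: ifP.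
  apply: le_trans (bnd J (fun l => lpn (index_iota 0 J) r (sh l)) _); last first.
    move=> l; rewrite -lee_fin -EX; apply: le_trans (lpn_le_lqcost x J r0).
    rewrite lee_fin; apply: le_lpn_sum => //; first exact: lpn_ge0.
    rewrite lpn_powR//.
    have [lJ|Jl] := leqP l J.
      rewrite (big_cat_nat _ lJ)//= big_nat big1 ?add0r; last first.
        by move=> i /andP[_ il]; rewrite /sh leqNgt il/= powR0 ?gt_eqF.
      rewrite -{1}(add0n l) -{1}(subnK lJ) big_addn addnK.
      rewrite (eq_bigr (fun i => x i `^ r)); last first.
        by move=> i _; rewrite /sh leq_addl addnK.
      rewrite [leRHS](big_cat_nat _ (leq_subr l J))//= lerDl.
      by apply: sumr_ge0 => i _; exact: powR_ge0.
    rewrite big_nat big1; first by apply: sumr_ge0 => i _; exact: powR_ge0.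
    move=> i /andP[_ il]; rewrite /sh leqNgt (ltn_trans il Jl)/= powR0 ?gt_eqF//.
  rewrite mulr_sumr.
  apply: (@le_trans _ _ (lpn (index_iota 0 J) r
      (fun j => \sum_(l <- index_enum 'I_J) K * (th ^+ l * sh l j)))).
    apply: le_lpn => // j; rewrite mem_index_iota => /andP[_ jJ].
    rewrite y0/= (le_trans (yx j))// mulr_sumr.
    rewrite -(big_mkord xpredT (fun l => K * (th ^+ l * x (j - l)%N))).
    rewrite -[leRHS](big_mkord xpredT (fun l => K * (th ^+ l * sh l j))).
    rewrite [leRHS](big_cat_nat _ jJ)//= -[leLHS]addr0 lerD//.
      rewrite !big_nat; apply: ler_sum => l /andP[_ lj].
      by rewrite /sh -ltnS lj.
    by apply: sumr_ge0 => l _; rewrite !mulr_ge0// exprn_ge0.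
  apply: le_trans (lpn_sum _ _ _) _ => //.
    by move=> l j _; rewrite !mulr_ge0// exprn_ge0.
  apply: ler_sum => l _.
  by rewrite lpnZ// ?lpnZ ?exprn_ge0// => *; rewrite mulr_ge0// exprn_ge0.
- move=> qy j; apply: le_trans (yx j) _.
  apply: (bnd j.+1 (fun l => x (j - l)%N)) => l.
  by rewrite -lee_fin -EX; exact: level_le_lqcost.
Qed.

End mixed_cost.

(** * Levels of the grid as finite lists, and the norms of their coefficients *)

Section cells.
Context {T : Type}.
Variable P : nat -> set (set T).

Definition cells k : seq (set T) := finmap.enum_fset (fset_set (P k)).

Hypothesis fP : forall k, finite_set (P k).

Lemma cellsP k W : reflect (P k W) (W \in cells k).
Proof.
apply: (iffP idP) => [|PW]; last by rewrite (in_fset_set (fP k)) mem_set.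
by move=> WE; apply/set_mem; rewrite -(in_fset_set (fP k)).
Qed.

Lemma cells_uniq k : uniq (cells k).
Proof. exact: finmap.fset_uniq. Qed.

Lemma fsum_cells (V : nmodType) k (F : set T -> V) :
  \sum_(Q \in P k) F Q = \sum_(Q <- cells k) F Q.
Proof. exact: fsbig_finite. Qed.

End cells.

Section level_norm.
Context {R : realType} {T : Type}.
Variables (P : nat -> set (set T)) (p : R).
Implicit Types (c : set T -> R[i]).

Definition lnorm c k : R :=
  lpn (cells P k) p (fun W => normc (c W)).

Lemma lnorm_ge0 c k : 0 <= lnorm c k.
Proof. exact: lpn_ge0. Qed.

Lemma cost_lqcost q c : 0 < p -> (forall k, finite_set (P k)) ->
  cost P p q c = lqcost q (lnorm c).
Proof.
move=> p0 fP.
have E k : \sum_(Q \in P k) normc (c Q) `^ p = lnorm c k `^ p.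
  by rewrite /lnorm lpn_powR// fsum_cells.
have E' k : (lnorm c k `^ p) `^ p^-1 = lnorm c k.
  by rewrite -powRrM mulfV ?gt_eqF// powRr1 ?lnorm_ge0.
case: q => [r||] /=.
- congr (_ `^ _)%E; congr (limn _); apply/funext => n; apply: eq_bigr => k _.
  by rewrite E -powRrM mulrC divfK ?gt_eqF.
- by congr ereal_sup; congr image; apply/funext => k; rewrite E E'.
- by congr ereal_sup; congr image; apply/funext => k; rewrite E E'.
Qed.

End level_norm.

(** * Domination and completeness in L^p *)

Section powR_continuity.
Context {R : realType}.

Lemma cvg_powR (u : nat -> R) (l p : R) : 0 < l -> u @ \oo --> l ->
  (fun n => u n `^ p) @ \oo --> l `^ p.
Proof.
move=> l0 ul.
have := @derivable_powR R 1 p l; rewrite in_itv/= l0/= => /(_ isT).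
move=> /derivable1_diffP /differentiable_continuous H.
exact: (@continuous_cvg _ _ _ _ _ u (fun x => x `^ p) l H ul).
Qed.

End powR_continuity.

Section measurable_complex_theory.
Context {R : realType} {d : measure_display} {T : measurableType d}.
Implicit Types (u v : T -> R[i]).

Lemma measurable_complex_cst (z : R[i]) :
  measurable_complex (fun _ : T => z).
Proof. by split; exact: measurable_cst. Qed.

Lemma measurable_complexD u v : measurable_complex u -> measurable_complex v ->
  measurable_complex (fun x => u x + v x).
Proof.
move=> [ru iu] [rv iv]; split.
- by under eq_fun do rewrite ReD; exact: measurable_funD.
- by under eq_fun do rewrite ImD; exact: measurable_funD.
Qed.

Lemma measurable_complexM u v : measurable_complex u -> measurable_complex v ->
  measurable_complex (fun x => u x * v x).
Proof.
move=> [ru iu] [rv iv].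
have E1 (z w : R[i]) : complex.Re (z * w) =
  complex.Re z * complex.Re w - complex.Im z * complex.Im w.
  by case: z w => [a b] [e f].
have E2 (z w : R[i]) : complex.Im (z * w) =
  complex.Re z * complex.Im w + complex.Im z * complex.Re w.
  by case: z w => [a b] [e f].
split.
- by under eq_fun do rewrite E1; apply: measurable_funB; exact: measurable_funM.
- by under eq_fun do rewrite E2; apply: measurable_funD; exact: measurable_funM.
Qed.

Lemma measurable_complexB u v : measurable_complex u -> measurable_complex v ->
  measurable_complex (fun x => u x - v x).
Proof.
move=> mu mv; under eq_fun do rewrite -mulN1r.
by apply: measurable_complexD => //; apply: measurable_complexM.
Qed.

Lemma measurable_complex_sum (I : Type) (r : seq I) (Q : pred I)
    (u : I -> T -> R[i]) :
  (forall i, Q i -> measurable_complex (u i)) ->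
  measurable_complex (fun x => \sum_(i <- r | Q i) u i x).
Proof.
move=> mu; elim: r => [|i r IH].
  by under eq_fun do rewrite big_nil; exact: (measurable_complex_cst 0).
have [Qi|/negPf Qi] := boolP (Q i); last first.
  by under eq_fun do rewrite big_cons Qi.
under eq_fun do rewrite big_cons Qi.
by apply: measurable_complexD => //; exact: mu.
Qed.

Lemma measurable_complex_real (f : T -> R) : measurable_fun setT f ->
  measurable_complex (fun x => (f x)%:C%C).
Proof. by move=> mf; split => //=; exact: measurable_cst. Qed.

Lemma measurable_complex_indic (A : set T) : measurable A ->
  measurable_complex (fun x => (\1_A x)%:C%C : R[i]).
Proof.
by move=> mA; apply: measurable_complex_real; exact: measurable_indic.
Qed.

Lemma measurable_normc u : measurable_complex u ->
  measurable_fun setT (fun x => normc (u x)).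
Proof.
move=> [mr mi].
have -> : (fun x => normc (u x)) =
    (@Num.sqrt R) \o (fun x => complex.Re (u x) ^+ 2 + complex.Im (u x) ^+ 2).
  by apply/funext => x /=; case: (u x).
apply: measurableT_comp.
  by apply: continuous_measurable_fun; exact: sqrt_continuous.
by apply: measurable_funD; exact: measurable_funX.
Qed.

End measurable_complex_theory.

Section Lp_domination.
Context {R : realType} {d : measure_display} {T : measurableType d}.
Variables (m : {measure set T -> \bar R}) (p : R).
Hypothesis p1 : 1 <= p.
Let p0 : 0 < p. Proof. exact: lt_le_trans p1. Qed.

Lemma Lnorm_integral (f : T -> R) : (forall x, 0 <= f x) ->
  Lnorm m p%:E (EFin \o f) = ((\int[m]_x (f x `^ p)%:E) `^ p^-1)%E.
Proof.
move=> f0; rewrite unlock.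
by under eq_integral => x _ do rewrite /= ger0_norm//.
Qed.

Lemma Lnorm_le (f g : T -> \bar R) : measurable_fun setT f ->
  measurable_fun setT g -> {ae m, forall x, (`|f x| <= `|g x|)%E} ->
  (Lnorm m p%:E f <= Lnorm m p%:E g)%E.
Proof.
move=> mf mg fg; rewrite unlock.
have mpow (h : T -> \bar R) : measurable_fun setT h ->
    measurable_fun setT (fun x => (`|h x| `^ p)%E).
  move=> mh; apply: (@measurableT_comp _ _ _ _ _ _ (fun x => x `^ p)%E) => //.
    exact: measurable_poweR.
  exact: measurableT_comp.
have pge0 (h : T -> \bar R) x : (0 <= `|h x| `^ p)%E by exact: poweR_ge0.
rewrite gt0_ler_poweR ?invr_ge0 ?(ltW p0)// ?in_itv/= ?leey ?andbT//.
- by apply: integral_ge0.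
- by apply: integral_ge0.
apply: ae_ge0_le_integral => //; [exact: mpow|exact: mpow|].
apply: filterS fg => x fgx _.
by rewrite gt0_ler_poweR ?(ltW p0)// ?in_itv/= ?leey ?andbT ?abse_ge0.
Qed.

Lemma Lnorm_sum (I : Type) (r : seq I) (f : I -> T -> R) :
  (forall i, measurable_fun setT (f i)) ->
  (Lnorm m p%:E (fun x => (\sum_(i <- r) f i x)%:E) <=
   \sum_(i <- r) Lnorm m p%:E (EFin \o f i))%E.
Proof.
move=> mf; elim: r => [|i r IH].
  rewrite big_nil; under eq_Lnorm do rewrite big_nil.
  by rewrite Lnorm0// gt_eqF// lte_fin.
rewrite big_cons; under eq_Lnorm do rewrite big_cons.
apply: le_trans (leeD2l _ IH).
by apply: minkowski_EFin => //; exact: measurable_sum.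
Qed.

(** The functions min(w, S_n), with S_n the partial sums, increase to w almost everywhere and have
    norm at most that of S_n; monotone convergence concludes. The minimum with w gives a finite
    limit even where the series diverges. *)
Lemma Lnorm_series (f : nat -> T -> R) (w : T -> R) :
  (forall k, measurable_fun setT (f k)) -> (forall k x, 0 <= f k x) ->
  measurable_fun setT w -> (forall x, 0 <= w x) ->
  {ae m, forall x, ((w x)%:E <= \sum_(0 <= k <oo) (f k x)%:E)%E} ->
  (Lnorm m p%:E (EFin \o w) <=
   \sum_(0 <= k <oo) Lnorm m p%:E (EFin \o f k))%E.
Proof.
move=> mf f0 mw w0 wf; set B := (leRHS).
have B0 : (0 <= B)%E by apply: nneseries_ge0 => k _ _; exact: Lnorm_ge0.
pose S n x := \sum_(0 <= k < n) f k x.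
have mS n : measurable_fun setT (S n) by exact: measurable_sum.
have S0 n x : 0 <= S n x by apply: sumr_ge0.
pose phi n x := Num.min (w x) (S n x).
have mphi n : measurable_fun setT (phi n) by exact: measurable_minr.
have phi0 n x : 0 <= phi n x by rewrite /phi le_min w0 S0.
pose g n x := (phi n x `^ p)%:E.
have mpow (h : T -> R) : measurable_fun setT h ->
    measurable_fun setT (fun x => (h x `^ p)%:E).
  move=> mh; apply/measurable_EFinP.
  by apply: (@measurableT_comp _ _ _ _ _ _ (fun x => x `^ p)).
have mg n : measurable_fun setT (g n) by exact: mpow.
have g0 n x : (0 <= g n x)%E by rewrite lee_fin powR_ge0.
have ndS x : nondecreasing_seq (S^~ x).
  by apply/nondecreasing_seqP => n; rewrite /S big_nat_recr//= lerDl.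
have ndg x : nondecreasing_seq (g^~ x).
  move=> a b ab; rewrite lee_fin ge0_ler_powR ?(ltW p0) ?nnegrE//.
  by rewrite /phi le_min ge_min lexx/= ge_min (ndS x _ _ ab) orbT.
have intg n : (\int[m]_x g n x <= B `^ p)%E.
  have -> : (\int[m]_x g n x = Lnorm m p%:E (EFin \o phi n) `^ p)%E.
    rewrite Lnorm_integral// -poweRrM mulVf ?gt_eqF// poweRe1//.
    by apply: integral_ge0 => x _; exact: g0.
  rewrite gt0_ler_poweR ?(ltW p0)// ?in_itv/= ?leey ?andbT ?Lnorm_ge0//.
  apply: (@le_trans _ _ (Lnorm m p%:E (EFin \o S n))).
    apply: Lnorm_le; [exact/measurable_EFinP|exact/measurable_EFinP|].
    by apply: aeW => x /=; rewrite lee_fin !ger0_norm// /phi ge_min lexx orbT.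
  apply: le_trans (Lnorm_sum _ mf) _.
  by apply: nneseries_lim_ge => k _ _; exact: Lnorm_ge0.
have mono := monotone_convergence m measurableT mg (fun n x _ => g0 n x)
  (fun x _ => ndg x).
suff key : (\int[m]_x (w x `^ p)%:E <= B `^ p)%E.
  rewrite Lnorm_integral//.
  have -> : B = ((B `^ p) `^ p^-1)%E by rewrite -poweRrM mulfV ?gt_eqF// poweRe1.
  rewrite gt0_ler_poweR ?invr_ge0 ?(ltW p0)// ?in_itv/= ?leey ?andbT ?poweR_ge0//.
  by apply: integral_ge0 => x _; rewrite lee_fin powR_ge0.
apply: (@le_trans _ _ (\int[m]_x (limn (g^~ x)))%E); last first.
  rewrite mono; apply: lime_le; last by apply: nearW => n; exact: intg.
  apply: ereal_nondecreasing_is_cvgn => a b ab.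
  by apply: ge0_le_integral => // x _; exact: ndg.
apply: ae_ge0_le_integral => //.
- by move=> x _; rewrite lee_fin powR_ge0.
- exact: mpow.
- move=> x _; apply: lime_ge; first exact: ereal_nondecreasing_is_cvgn.
  exact: nearW.
- apply: (emeasurable_fun_cvg g) => // x _.
  exact: ereal_nondecreasing_is_cvgn.
apply: filterS wf => x wx _.
(* The value 0 is separated because [cvg_powR] asks for a positive limit. *)
have [w00|wpos] := eqVneq (w x) 0.
  rewrite w00 powR0 ?gt_eqF//; apply: lime_ge.
    exact: ereal_nondecreasing_is_cvgn.
  exact: nearW.
have {}wpos : 0 < w x by rewrite lt0r wpos w0.
suff H : (fun n => phi n x) @ \oo --> w x.
  rewrite le_eqVlt; apply/orP; left; apply/eqP/esym/cvg_lim => //.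
  by have H' := cvg_powR (p:=p) wpos H; apply/fine_cvgP; split; [exact: nearW|exact: H'].
apply/cvgrPdist_le => e e0.
have : ((w x - e)%:E < \sum_(0 <= k <oo) (f k x)%:E)%E.
  by apply: lt_le_trans wx; rewrite lte_fin ltrBlDr ltrDl.
move=> /lte_lim wlim.
have {wlim} : \forall n \near \oo, ((w x - e)%:E <= (S n x)%:E)%E.
  under eq_near => n do rewrite /S -sumEFin.
  apply: wlim; last by apply: is_cvg_nneseries => k _ _; rewrite lee_fin.
  by apply: ereal_nondecreasing_series => k _ _; rewrite lee_fin.
apply: filterS => n; rewrite lee_fin => wS.
rewrite ger0_norm ?subr_ge0 /phi ?ge_min ?lexx//.
by rewrite lerBlDr -lerBlDl le_min wS gerBl ltW.
Qed.

End Lp_domination.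

Lemma ereal_cvg0P (R : realType) (a : nat -> \bar R) :
  (forall n, (0 <= a n)%E) ->
  a @ \oo --> 0%E <->
  forall e : R, 0 < e -> exists K, forall n, (K <= n)%N -> (a n <= e%:E)%E.
Proof.
move=> a0; split => [/fine_cvgP[afin /cvgrPdist_le acvg] e e0|H].
  have [K _ HK] := filterI afin (acvg _ e0).
  exists K => n Kn; have [afn] := HK _ Kn.
  by rewrite /= sub0r normrN ger0_norm ?fine_ge0// -lee_fin fineK.
apply/fine_cvgP; split.
  have [K HK] := H 1 ltr01; exists K => // n Kn.
  by rewrite ge0_fin_numE// (le_lt_trans (HK _ Kn))// ltry.
apply/cvgrPdist_le => e e0; have [K HK] := H e e0; exists K => // n Kn.
rewrite /= sub0r normrN ger0_norm ?fine_ge0// -lee_fin fineK ?HK//.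
by rewrite ge0_fin_numE// (le_lt_trans (HK _ Kn))// ltry.
Qed.

Lemma ereal_squeeze0 (R : realType) (a b : nat -> \bar R) :
  (forall n, (0 <= a n)%E) -> (forall n, (a n <= b n)%E) ->
  b @ \oo --> 0%E -> a @ \oo --> 0%E.
Proof.
move=> a0 ab b0; apply: (squeeze_cvge _ (cvg_cst 0%E) b0).
by apply: nearW => n; rewrite a0 ab.
Qed.

Lemma geometric_cvg0 (R : realType) (a : nat -> \bar R) (B mu : R) :
  0 <= mu -> mu < 1 -> (forall n, (0 <= a n)%E) ->
  (forall n, (a n <= (B * mu ^+ n)%:E)%E) -> a @ \oo --> 0%E.
Proof.
move=> mu0 mu1 a0 aB; apply: (ereal_squeeze0 a0 aB).
have H : (fun n => B * mu ^+ n) @ \oo --> 0.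
  have := cvg_geometric B (z := mu); rewrite ger0_norm//; exact.
by apply/fine_cvgP; split; [exact: nearW|exact: H].
Qed.

Section LpNorm_theory.
Context {R : realType} {d : measure_display} {T : measurableType d}.
Variables (m : {measure set T -> \bar R}) (p : R).
Hypothesis p1 : 1 <= p.
Let p0 : 0 < p. Proof. exact: lt_le_trans p1. Qed.
Implicit Types (u v w g f : T -> R[i]).
Local Notation N := (LpNorm m p).

Lemma LpNorm_ge0 u : (0 <= N u)%E. Proof. exact: Lnorm_ge0. Qed.

Lemma LpNorm_sum_dom (I : Type) (r : seq I) w (v : I -> T -> R[i]) :
  measurable_complex w -> (forall i, measurable_complex (v i)) ->
  (forall x, normc (w x) <= \sum_(i <- r) normc (v i x)) ->
  (N w <= \sum_(i <- r) N (v i))%E.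
Proof.
move=> mw mv wv.
have mnv i := measurable_normc (mv i).
apply: le_trans (Lnorm_sum m p1 r mnv).
apply: Lnorm_le => //.
- by apply/measurable_EFinP; exact: measurable_normc.
- by apply/measurable_EFinP; exact: measurable_sum.
apply: aeW => x; rewrite !gee0_abs ?lee_fin ?normc_ge0//.
by apply: sumr_ge0 => i _; exact: normc_ge0.
Qed.

Lemma LpNorm_dom w v : measurable_complex w -> measurable_complex v ->
  (forall x, normc (w x) <= normc (v x)) -> (N w <= N v)%E.
Proof.
move=> mw mv wv.
have := @LpNorm_sum_dom unit [:: tt] w (fun=> v) mw (fun=> mv).
by rewrite big_seq1; apply=> x; rewrite big_seq1.
Qed.

Lemma LpNormD u v : measurable_complex u -> measurable_complex v ->
  (N (fun x => u x + v x)%R <= N u + N v)%E.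
Proof.
move=> mu mv.
have := @LpNorm_sum_dom bool [:: true; false] (fun x => u x + v x)
  (fun b => if b then u else v).
rewrite !big_cons big_nil adde0; apply.
- exact: measurable_complexD.
- by case.
- by move=> x; rewrite !big_cons big_nil addr0 normcD.
Qed.

Lemma LpNorm_series_dom w (v : nat -> T -> R[i]) :
  measurable_complex w -> (forall k, measurable_complex (v k)) ->
  {ae m, forall x, ((normc (w x))%:E <=
    \sum_(0 <= k <oo) (normc (v k x))%:E)%E} ->
  (N w <= \sum_(0 <= k <oo) N (v k))%E.
Proof.
move=> mw mv wv.
apply: (Lnorm_series (f := fun k x => normc (v k x)) p1) => //.
- by move=> k; exact: measurable_normc.
- by move=> k x; exact: normc_ge0.
- exact: measurable_normc.
- by move=> x; exact: normc_ge0.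
Qed.

Lemma LpNorm0 : N (fun=> 0) = 0%E.
Proof.
rewrite /LpNorm normc0; apply: (Lnorm0 m (p := p%:E)).
by rewrite gt_eqF// lte_fin.
Qed.

Lemma LpNormZ (z : R[i]) u : measurable_complex u ->
  N (fun x => z * u x) = ((normc z)%:E * N u)%E.
Proof.
move=> mu; rewrite /LpNorm.
rewrite (Lnorm_integral m p (f := fun x => normc (z * u x))); last first.
  by move=> x; exact: normc_ge0.
rewrite (Lnorm_integral m p (f := fun x => normc (u x))); last first.
  by move=> x; exact: normc_ge0.
have -> : (\int[m]_x (normc (z * u x)%R `^ p)%:E =
    (normc z `^ p)%:E * \int[m]_x (normc (u x) `^ p)%:E)%E.
  rewrite -ge0_integralZl//.
  - apply: eq_integral => x _.
    by rewrite normcM powRM ?normc_ge0.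
  - apply/measurable_EFinP.
    apply: (@measurableT_comp _ _ _ _ _ _ (fun x => x `^ p)) => //.
    exact: measurable_normc.
  - by move=> x _; rewrite lee_fin powR_ge0.
  - by rewrite lee_fin powR_ge0.
rewrite poweRM ?lee_fin ?powR_ge0//; last first.
  by apply: integral_ge0 => x _; rewrite lee_fin powR_ge0.
by rewrite poweR_EFin -powRrM mulfV ?gt_eqF// powRr1 ?normc_ge0.
Qed.

Lemma LpNorm_eq0 u : measurable_complex u -> N u = 0%E ->
  {ae m, forall x, u x = 0}.
Proof.
move=> mu u0; have mn := measurable_normc mu.
have /(_ _ _ u0) := @Lnorm_eq0_eq0 _ _ _ m (EFin \o (fun x => normc (u x))) p%:E.
rewrite lte_fin => /(_ _ p0) => H.
have {}H := H ((measurable_EFinP _ _).2 mn).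
apply: filterS H => x /(_ I) /= [] /eqP; rewrite normc_eq0 => /eqP; exact.
Qed.

Lemma eq_LpNorm u v : (forall x, u x = v x) -> N u = N v.
Proof. by move=> uv; congr LpNorm; apply/funext. Qed.

Lemma eq_Lp_cvg (a b : nat -> T -> R[i]) f g :
  (forall x, f x = g x) ->
  (exists K, forall n x, (K <= n)%N -> a n x = b n x) ->
  Lp_cvg m p a f -> Lp_cvg m p b g.
Proof.
move=> fg [K ab] /ereal_cvg0P H; apply/ereal_cvg0P => [n|e e0].
  exact: LpNorm_ge0.
have [|K' HK'] := H _ e e0; first by move=> n; exact: LpNorm_ge0.
exists (maxn K K') => n; rewrite geq_max => /andP[Kn K'n].
rewrite (eq_LpNorm (v := fun x => f x - a n x)) ?HK'// => x.
by rewrite fg ab.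
Qed.

Lemma Lp_cvgD (a b : nat -> T -> R[i]) f g :
  (forall n, measurable_complex (a n)) -> (forall n, measurable_complex (b n)) ->
  measurable_complex f -> measurable_complex g ->
  Lp_cvg m p a f -> Lp_cvg m p b g ->
  Lp_cvg m p (fun n x => a n x + b n x) (fun x => f x + g x).
Proof.
move=> ma mb mf mg af bg.
apply: (ereal_squeeze0 (b := fun n => N (fun x => f x - a n x)%R + N (fun x => g x - b n x)%R)%E).
- by move=> n; exact: LpNorm_ge0.
- move=> n; rewrite -(eq_LpNorm (u := fun x => (f x - a n x) + (g x - b n x))).
    by apply: LpNormD; exact: measurable_complexB.
  by move=> x; rewrite opprD addrACA.
- by have := cvgeD (isT : (0 +? 0)%E) af bg; rewrite adde0; exact.
Qed.

Lemma Lp_cvgZ (z : R[i]) (a : nat -> T -> R[i]) f :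
  (forall n, measurable_complex (a n)) -> measurable_complex f ->
  Lp_cvg m p a f -> Lp_cvg m p (fun n x => z * a n x) (fun x => z * f x).
Proof.
move=> ma mf af; rewrite /Lp_cvg.
under eq_fun => n.
  rewrite (eq_LpNorm (v := fun x => z * (f x - a n x))); last first.
    by move=> x; rewrite mulrBr.
  rewrite LpNormZ; last exact: measurable_complexB.
  over.
by have := cvgeZl (y := (normc z)%:E) isT af; rewrite mule0; exact.
Qed.

Lemma Lp_cvg_cst f : Lp_cvg m p (fun _ => f) f.
Proof.
rewrite /Lp_cvg; under eq_fun => n.
  rewrite (eq_LpNorm (v := fun=> 0)); last by move=> x; rewrite subrr.
  rewrite LpNorm0; over.
exact: cvg_cst.
Qed.

Lemma Lp_cvg_sum (I : eqType) (r : seq I) (a : I -> nat -> T -> R[i])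
    (f : I -> T -> R[i]) :
  (forall i n, i \in r -> measurable_complex (a i n)) ->
  (forall i, i \in r -> measurable_complex (f i)) ->
  (forall i, i \in r -> Lp_cvg m p (a i) (f i)) ->
  Lp_cvg m p (fun n x => \sum_(i <- r) a i n x) (fun x => \sum_(i <- r) f i x).
Proof.
elim: r => [|i r IH] ma mf af.
  apply: eq_Lp_cvg (Lp_cvg_cst (fun=> 0)).
    by move=> x; rewrite big_nil.
  by exists 0%N => n x _; rewrite big_nil.
have ir j : j \in r -> j \in i :: r by move=> jr; rewrite inE jr orbT.
have msum (h : I -> T -> R[i]) : (forall j, j \in r -> measurable_complex (h j)) ->
    measurable_complex (fun x => \sum_(j <- r) h j x).
  move=> mh; under eq_fun do rewrite big_seq.
  exact: measurable_complex_sum.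
have H := @Lp_cvgD (a i) (fun n x => \sum_(i <- r) a i n x) (f i)
  (fun x => \sum_(i <- r) f i x).
apply: eq_Lp_cvg (H _ _ _ _ (af i (mem_head _ _)) (IH _ _ _)).
- by move=> x; rewrite big_cons.
- by exists 0%N => n x _; rewrite big_cons.
- by move=> n; apply: ma; exact: mem_head.
- by move=> n; apply: msum => j /ir; exact: ma.
- by apply: mf; exact: mem_head.
- by apply: msum => j /ir; exact: mf.
- by move=> j n /ir; exact: ma.
- by move=> j /ir; exact: mf.
- by move=> j /ir; exact: af.
Qed.

End LpNorm_theory.

(** * Absolutely summable series, in the complex numbers and in L^p *)

Lemma sum_nat_split (V : nmodType) (u : nat -> V) (J n : nat) :
  \sum_(0 <= k < J + n) u k =
  \sum_(0 <= k < J) u k + \sum_(0 <= k < n) u (k + J)%N.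
Proof.
rewrite (@big_cat_nat _ _ _ J)//= ?leq_addr//; congr (_ + _).
by rewrite -{1}(add0n J) big_addn addKn.
Qed.

Section abs_summable.
Context {R : realType}.

Lemma abs_bounded_cvg_series (v : nat -> R) (B : R) :
  (forall n, \sum_(0 <= k < n) `|v k| <= B) -> cvgn (series v).
Proof.
move=> vB; apply: normed_cvg; apply: nondecreasing_is_cvgn.
  by apply: nondecreasing_series => k _ _; exact: normr_ge0.
by exists B => _ [n _ <-]; exact: vB.
Qed.

Lemma dist_lim_series (v : nat -> R) J (b : \bar R) : cvgn (series v) ->
  (\sum_(0 <= k <oo) (`|v (k + J)%N|)%:E <= b)%E ->
  ((`|limn (series v) - \sum_(0 <= k < J) v k|)%:E <= b)%E.
Proof.
move=> cv; case: b => [b||] Hb; last 2 first.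
- by rewrite leey.
- exfalso; move: Hb; rewrite leeNy_eq => /eqP Hb.
  have : (0 <= -oo :> \bar R)%E.
    by rewrite -Hb; apply: nneseries_ge0 => k _ _; rewrite lee_fin.
  by [].
rewrite lee_fin.
have H : (fun n => `|series v n - \sum_(0 <= k < J) v k|) @ \oo -->
    `|limn (series v) - \sum_(0 <= k < J) v k|.
  by apply: cvg_norm; apply: cvgB => //; exact: cvg_cst.
have <- := cvg_lim (@Rhausdorff R) H.
apply: limr_le; first by apply/cvg_ex; eexists; exact: H.
exists J => // n /= Jn; rewrite /series/= -(subnKC Jn) sum_nat_split.
rewrite addrAC subrr add0r (le_trans (ler_norm_sum _ _ _))// -lee_fin -sumEFin.
by apply: le_trans Hb; apply: nneseries_lim_ge => k _ _; rewrite lee_fin.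
Qed.

Implicit Types (u : nat -> R[i]).

(** Real and imaginary parts are summed separately, so that convergence and measurability reduce to
    real limits. The value is meaningful under [abs_bounded]. *)
Definition csum u : R[i] := Complex (limn (series (fun k => complex.Re (u k))))
  (limn (series (fun k => complex.Im (u k)))).

Definition abs_bounded u := exists B : R,
  forall n, \sum_(0 <= k < n) normc (u k) <= B.

Lemma abs_bounded_Re u : abs_bounded u ->
  cvgn (series (fun k => complex.Re (u k))).
Proof.
move=> [B uB]; apply: (@abs_bounded_cvg_series _ B) => n.
by apply: le_trans (uB n); apply: ler_sum => k _; exact: normc_Re.
Qed.

Lemma abs_bounded_Im u : abs_bounded u ->
  cvgn (series (fun k => complex.Im (u k))).
Proof.
move=> [B uB]; apply: (@abs_bounded_cvg_series _ B) => n.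
by apply: le_trans (uB n); apply: ler_sum => k _; exact: normc_Im.
Qed.

Lemma csum_dist u J : normc (csum u - \sum_(0 <= k < J) u k) <=
  `|limn (series (fun k => complex.Re (u k))) -
      \sum_(0 <= k < J) complex.Re (u k)| +
  `|limn (series (fun k => complex.Im (u k))) -
      \sum_(0 <= k < J) complex.Im (u k)|.
Proof.
apply: le_trans (normc_le_ReIm _) _; apply: lerD.
- by rewrite raddfB/= Re_sum.
- by rewrite raddfB/= Im_sum.
Qed.

Lemma csum_cvg u : abs_bounded u ->
  (fun n => normc (csum u - \sum_(0 <= k < n) u k)) @ \oo --> 0.
Proof.
move=> ub; have cr := abs_bounded_Re ub; have ci := abs_bounded_Im ub.
have H (v : nat -> R) : cvgn (series v) ->
    (fun n => `|limn (series v) - \sum_(0 <= k < n) v k|) @ \oo --> 0.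
  move=> cv; have := cvg_norm (cvgB (@cvg_cst _ (limn (series v)) _ _ _) cv).
  by rewrite subrr normr0; exact.
have := cvgD (H _ cr) (H _ ci); rewrite addr0 => H0.
apply: squeeze_cvgr; [|exact: (@cvg_cst _ (0:R))|exact: H0].
by apply: nearW => n; rewrite normc_ge0/= csum_dist.
Qed.

(** The factor 2 arises because the tails of the real and of the imaginary part are each estimated
    by the full modulus. *)
Lemma csum_tail u J : abs_bounded u ->
  ((normc (csum u - \sum_(0 <= k < J) u k))%:E <=
   \sum_(0 <= k <oo) (2 * normc (u (k + J)%N))%:E)%E.
Proof.
move=> ub; have cr := abs_bounded_Re ub; have ci := abs_bounded_Im ub.
apply: (@le_trans _ _ (\sum_(0 <= k <oo) (normc (u (k + J)%N))%:E +
                       \sum_(0 <= k <oo) (normc (u (k + J)%N))%:E)%E).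
  apply: (@le_trans _ _ (_%:E + _%:E)%E).
    by rewrite -EFinD lee_fin; exact: csum_dist.
  apply: leeD.
  - apply: dist_lim_series => //; apply: lee_nneseries => k *.
      by rewrite lee_fin.
    by rewrite lee_fin normc_Re.
  - apply: dist_lim_series => //; apply: lee_nneseries => k *.
      by rewrite lee_fin.
    by rewrite lee_fin normc_Im.
rewrite -nneseriesD; try by move=> k *; rewrite lee_fin normc_ge0.
apply: lee_nneseries => k *; first by rewrite adde_ge0// lee_fin normc_ge0.
by rewrite -EFinD mulr2n mulrDl mul1r.
Qed.

End abs_summable.

Lemma nneseries_geometric_le (R : realType) (a : nat -> \bar R) (B mu : R) :
  0 <= B -> 0 <= mu -> mu < 1 -> (forall k, (0 <= a k)%E) ->
  (forall k, (a k <= (B * mu ^+ k)%:E)%E) ->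
  (\sum_(0 <= k <oo) a k <= (B / (1 - mu))%:E)%E.
Proof.
move=> B0 mu0 mu1 a0 aB.
apply: (@le_trans _ _ (\sum_(0 <= k <oo) (B * mu ^+ k)%:E)%E).
  by apply: lee_nneseries.
apply: lime_le.
  by apply: is_cvg_nneseries => k _ _; rewrite lee_fin mulr_ge0// exprn_ge0.
apply: nearW => n; rewrite sumEFin lee_fin -mulr_sumr ler_wpM2l//.
by rewrite big_mkord sum_expr_le.
Qed.

Section Lp_series.
Context {R : realType} {d : measure_display} {T : measurableType d}.
Variables (m : {measure set T -> \bar R}) (p : R).
Hypothesis p1 : 1 <= p.
Let p0 : 0 < p. Proof. exact: lt_le_trans p1. Qed.
Implicit Types (u v w g f : T -> R[i]) (l : nat -> T -> R[i]).
Local Notation N := (LpNorm m p).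

(** The positive part [phi] of |f - S_J| minus the series of moduli is at most |f - S_(J+n)| for
    every n, by the triangle inequality. Hence its norm is below every positive number, and [phi]
    vanishes almost everywhere. No subsequence is extracted. *)
Lemma Lp_cvg_series_ae l f J : measurable_complex f ->
  (forall k, measurable_complex (l k)) ->
  Lp_cvg m p (fun n x => \sum_(0 <= k < n) l k x) f ->
  {ae m, forall x, ((normc (f x - \sum_(0 <= k < J) l k x))%:E <=
     \sum_(0 <= k <oo) (normc (l (k + J)%N x))%:E)%E}.
Proof.
move=> mf ml lf.
pose F x := (\sum_(0 <= k <oo) (normc (l (k + J)%N x))%:E)%E.
pose D n x := f x - \sum_(0 <= k < n) l k x.
have mD n : measurable_complex (D n).
  by apply: measurable_complexB => //; apply: measurable_complex_sum.
have mF : measurable_fun setT F.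
  apply: (emeasurable_fun_cvg
    (fun n x => \sum_(0 <= k < n) (normc (l (k + J)%N x))%:E)%E) => [n|x _].
    apply: emeasurable_sum => k; apply/measurable_EFinP.
    exact: measurable_normc.
  by apply: is_cvg_nneseries => k _ _; rewrite lee_fin normc_ge0.
pose phi x := maxe ((normc (D J x))%:E - F x)%E 0%E.
have phi0 x : (0 <= phi x)%E by rewrite /phi le_max lexx orbT.
have mphi : measurable_fun setT phi.
  apply: measurable_maxe => //; apply: emeasurable_funB => //.
  by apply/measurable_EFinP; exact: measurable_normc.
have phiD n x : (phi x <= (normc (D (J + n)%N x))%:E)%E.
  rewrite /phi ge_max lee_fin normc_ge0 andbT.
  apply: (@le_trans _ _ ((normc (D J x))%:E -
      \sum_(0 <= k < n) (normc (l (k + J)%N x))%:E)%E).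
    apply: leeB => //; apply: nneseries_lim_ge => k _ _.
    by rewrite lee_fin normc_ge0.
  rewrite sumEFin -EFinB lee_fin lerBlDr.
  apply: le_trans (lerD (lexx _) (normc_sum _ _ _)).
  apply: le_trans (normcD _ _).
  by rewrite /D sum_nat_split opprD addrA subrK.
have Nphi : Lnorm m p%:E phi = 0%E.
  apply/eqP; rewrite eq_le Lnorm_ge0 andbT; apply/lee_addgt0Pr => e e0.
  rewrite add0e.
  have [|K HK] := (ereal_cvg0P _).1 lf _ e0.
    by move=> n; exact: LpNorm_ge0.
  apply: le_trans (HK (J + K)%N (leq_addl _ _)).
  apply: Lnorm_le => //; first by apply/measurable_EFinP; exact: (measurable_normc (mD (J + K)%N)).
  apply: aeW => x; rewrite (gee0_abs (phi0 x)) gee0_abs ?lee_fin ?normc_ge0//.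
  exact: phiD.
have := Lnorm_eq0_eq0 mphi _ Nphi; rewrite lte_fin => /(_ p0).
apply: filterS => x /(_ I) /= phix.
have : ((normc (D J x))%:E - F x <= phi x)%E by rewrite /phi le_max lexx.
by rewrite phix sube_le0.
Qed.

(** The almost everywhere bound of the remainder of [f] is multiplied by [g] pointwise, so neither
    boundedness of [g] nor integrability of [g f] is presupposed. With [g] equal to 1 this is the
    usual tail estimate. *)
Lemma Lp_tail l f g J (B mu : R) : measurable_complex f ->
  measurable_complex g -> (forall k, measurable_complex (l k)) ->
  0 <= B -> 0 <= mu -> mu < 1 ->
  Lp_cvg m p (fun n x => \sum_(0 <= k < n) l k x) f ->
  (forall k, (N (fun x => g x * l (k + J)%N x)%R <= (B * mu ^+ k)%:E)%E) ->
  (N (fun x => g x * f x - \sum_(0 <= k < J) g x * l k x)%R <=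
    (B / (1 - mu))%:E)%E.
Proof.
move=> mf mg ml B0 mu0 mu1 lf lB.
have ae := Lp_cvg_series_ae J mf ml lf.
apply: le_trans (nneseries_geometric_le B0 mu0 mu1 _ lB); last first.
  by move=> k; exact: LpNorm_ge0.
apply: LpNorm_series_dom => //.
- apply: measurable_complexB; first exact: measurable_complexM.
  by apply: measurable_complex_sum => k _; exact: measurable_complexM.
- by move=> k; exact: measurable_complexM.
apply: filterS ae => x fx.
rewrite -mulr_sumr -mulrBr normcM EFinM.
apply: (@le_trans _ _ ((normc (g x))%:E *
   \sum_(0 <= k <oo) (normc (l (k + J)%N x))%:E)%E).
  by rewrite lee_wpmul2l// lee_fin normc_ge0.
rewrite -nneseriesZl; last by move=> k _; rewrite lee_fin normc_ge0.
apply: lee_nneseries => k *; first by rewrite -EFinM lee_fin mulr_ge0// normc_ge0.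
by rewrite normcM.
Qed.

(** The series is summed pointwise on the set [A] where the moduli have a finite sum, and replaced
    by zero elsewhere. The limit is thus an honest measurable function, and the explicit rate in J
    follows from [csum_tail]. *)
Lemma Lp_geometric_complete l (B mu : R) :
  (forall k, measurable_complex (l k)) -> 0 <= B -> 0 <= mu -> mu < 1 ->
  (forall k, (N (l k) <= (B * mu ^+ k)%:E)%E) ->
  exists2 h, measurable_complex h &
    forall J, (N (fun x => h x - \sum_(0 <= k < J) l k x)%R <=
               (2 * B * mu ^+ J / (1 - mu))%:E)%E.
Proof.
move=> ml B0 mu0 mu1 lB.
pose F x := (\sum_(0 <= k <oo) (normc (l k x))%:E)%E.
have F0 x : (0 <= F x)%E.
  by apply: nneseries_ge0 => k _ _; rewrite lee_fin normc_ge0.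
have mF : measurable_fun setT F.
  apply: (emeasurable_fun_cvg
    (fun n x => \sum_(0 <= k < n) (normc (l k x))%:E)%E) => [n|x _].
    apply: emeasurable_sum => k; apply/measurable_EFinP.
    exact: measurable_normc.
  by apply: is_cvg_nneseries => k _ _; rewrite lee_fin normc_ge0.
pose A := [set x | F x \is a fin_num].
have mA : measurable A.
  by rewrite -(setTI A); exact: emeasurable_fin_num.
have aeA : {ae m, forall x, A x}.
  pose w x : R[i] := (\1_(~` A) x)%:C%C.
  have mw : measurable_complex w.
    by apply: measurable_complex_indic; exact: measurableC.
  (* Off [A] the series [F] is infinite and so exceeds every multiple of the indicator; all
     multiples of the norm of [w] then stay below one constant, which forces that norm to be
     zero. *)
  have wb (c : nat) : ((c%:R)%:E * N w <= (B / (1 - mu))%:E)%E.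
    rewrite -[c%:R]ger0_norm// -normc_real -LpNormZ//.
    apply: le_trans (nneseries_geometric_le B0 mu0 mu1 _ lB); last first.
      by move=> k; exact: LpNorm_ge0.
    apply: LpNorm_series_dom => //.
      by apply: measurable_complexM => //; exact: measurable_complex_cst.
    apply: aeW => x; rewrite normcM !normc_real /w indicE.
    have [/set_mem/= xA|xA] := boolP (x \in ~` A); last first.
      by rewrite normr0 mulr0; exact: F0.
    rewrite -/(F x); have -> : F x = +oo%E; last by rewrite leey.
    by apply/eqP; rewrite -[_ == _]negbK -ltey -ge0_fin_numE//; exact/negP.
  have w0 : N w = 0%E.
    apply/eqP; rewrite eq_le LpNorm_ge0 andbT.
    have Nw0 := LpNorm_ge0 m p w.
    have fw : N w \is a fin_num.
      by rewrite ge0_fin_numE//; have := wb 1%N; rewrite mul1e => /le_lt_trans ->//; rewrite ltry.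
    rewrite -(fineK fw) lee_fin leNgt; apply/negP => wpos.
    pose c := (Num.truncn ((B / (1 - mu)) / fine (N w))).+1.
    have := wb c; rewrite -(fineK fw) -EFinM lee_fin -ler_pdivlMr//.
    by rewrite leNgt truncnS_gt.
  apply: filterS (LpNorm_eq0 p1 mw w0) => x; rewrite /w indicE => wx.
  apply: contrapT => xA; move: wx; rewrite mem_set//=.
  by move=> [] /eqP; rewrite oner_eq0.
(* Cutting by the indicator of [A] makes the series absolutely bounded at every point, so that
   measurability of the sum holds everywhere. *)
pose l' k x := (\1_A x)%:C%C * l k x : R[i].
have ml' k : measurable_complex (l' k).
  by apply: measurable_complexM => //; exact: measurable_complex_indic.
have bl' x : abs_bounded (l'^~ x).
  exists (if x \in A then fine (F x) else 0) => n; rewrite /l' indicE.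
  have [xA|xA] := boolP (x \in A); last first.
    by rewrite big1// => k _; rewrite mul0r normc0.
  rewrite -lee_fin fineK; last exact: (set_mem xA).
  rewrite -sumEFin; under eq_bigr do rewrite mul1r.
  by apply: nneseries_lim_ge => k _ _; rewrite lee_fin normc_ge0.
pose h x := csum (l'^~ x).
have mh : measurable_complex h.
  split.
  - apply: (measurable_fun_cvg
      (h := fun n x => \sum_(0 <= k < n) complex.Re (l' k x))) => [n|x _].
      by apply: measurable_sum => k; exact: (ml' k).1.
    exact: abs_bounded_Re (bl' x).
  - apply: (measurable_fun_cvg
      (h := fun n x => \sum_(0 <= k < n) complex.Im (l' k x))) => [n|x _].
      by apply: measurable_sum => k; exact: (ml' k).2.
    exact: abs_bounded_Im (bl' x).
exists h => // J.
have B20 : 0 <= 2 * B * mu ^+ J by rewrite !mulr_ge0// exprn_ge0.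
have H k : (N (fun x => (2%:R)%:C%C * l (k + J)%N x)%R <=
    (2 * B * mu ^+ J * mu ^+ k)%:E)%E.
  rewrite LpNormZ// normc_real ger0_norm// -!mulrA -exprD addnC EFinM.
  by rewrite lee_wpmul2l ?lee_fin// addnC.
apply: le_trans (nneseries_geometric_le B20 mu0 mu1 _ H); last first.
  by move=> k; exact: LpNorm_ge0.
apply: LpNorm_series_dom => //.
- by apply: measurable_complexB => //; apply: measurable_complex_sum.
- by move=> k; apply: measurable_complexM => //; exact: measurable_complex_cst.
apply: filterS aeA => x xA.
have E k : l' k x = l k x by rewrite /l' indicE mem_set// mul1r.
under [X in csum _ - X]eq_bigr do rewrite -E.
under eq_eseriesr => k _ do rewrite normcM normc_real ger0_norm// -E.
exact: csum_tail.
Qed.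

End Lp_series.

(** * Geometry of a good grid *)

Section grid_geometry.
Context {R : realType} {d : measure_display} {T : measurableType d}.
Variables (m : {finite_measure set T -> \bar R}) (P : nat -> set (set T)).
Hypothesis gP : good_grid m P.
Variable l2 : R.
Hypotheses (l20 : 0 <= l2) (l2lt1 : l2 < 1).
Hypothesis ratio : forall k Q Q', P k.+1 Q -> P k Q' -> Q `<=` Q' ->
  vol m Q <= l2 * vol m Q'.
Local Notation vol := (vol m).

Lemma vol_ge0 (Q : set T) : 0 <= vol Q.
Proof. by rewrite fine_ge0. Qed.

Lemma volK (Q : set T) : measurable Q -> (vol Q)%:E = m Q.
Proof. by move=> mQ; rewrite fineK// fin_num_measure. Qed.

Lemma le_vol (A B : set T) : measurable A -> measurable B -> A `<=` B ->
  vol A <= vol B.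
Proof.
move=> mA mB AB; rewrite -lee_fin !volK//.
by apply: le_measure; rewrite ?inE.
Qed.

Lemma cell_vol_gt0 k Q : P k Q -> 0 < vol Q.
Proof.
move=> PQ; rewrite -lte_fin volK; last exact: (grid_measurable gP PQ).
exact: (grid_pos gP PQ).
Qed.

Lemma cell_nonempty k Q : P k Q -> Q !=set0.
Proof.
move=> PQ; apply/set0P/eqP => Q0; have := cell_vol_gt0 PQ.
by rewrite /Defs.vol Q0 measure0 ltxx.
Qed.

Lemma cell_disjoint k Q Q' x : P k Q -> P k Q' -> Q x -> Q' x -> Q = Q'.
Proof.
by move=> PQ PQ' Qx Q'x; apply: (grid_disjoint gP PQ PQ'); exists x.
Qed.

Lemma cell_ancestor k j W : (k <= j)%N -> P j W ->
  exists2 Q, P k Q & W `<=` Q.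
Proof.
move=> kj; elim: j kj W => [|j IH].
  by rewrite leqn0 => /eqP -> W PW; exists W.
rewrite leq_eqVlt => /predU1P[-> W PW|]; first by exists W.
rewrite ltnS => /IH {}IH W PW; have [W' PW' WW'] := grid_nested gP PW.
by have [Q PQ W'Q] := IH _ PW'; exists Q => // x /WW'/W'Q.
Qed.

Lemma cell_nested k j Q W x : (k <= j)%N -> P k Q -> P j W -> Q x -> W x ->
  W `<=` Q.
Proof.
move=> kj PQ PW Qx Wx; have [Q' PQ' WQ'] := cell_ancestor kj PW.
by rewrite (cell_disjoint PQ PQ' Qx (WQ' _ Wx)).
Qed.

Lemma vol_decay k j Q W : (k <= j)%N -> P k Q -> P j W -> W `<=` Q ->
  vol W <= l2 ^+ (j - k) * vol Q.
Proof.
move=> kj PQ; elim: j kj W => [|j IH].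
  rewrite leqn0 => /eqP -> W PW WQ; rewrite expr0 mul1r.
  by apply: le_vol => //; [exact: (grid_measurable gP PW)|exact: (grid_measurable gP PQ)].
rewrite leq_eqVlt => /predU1P[-> W PW WQ|].
  rewrite subnn expr0 mul1r.
  by apply: le_vol => //; [exact: (grid_measurable gP PW)|exact: (grid_measurable gP PQ)].
rewrite ltnS => kj W PW WQ; have [W' PW' WW'] := grid_nested gP PW.
have [x Wx] := cell_nonempty PW.
rewrite subSn// exprS -mulrA (le_trans (ratio PW PW' WW'))// ler_wpM2l//.
by apply: IH => //; exact: (cell_nested kj PQ PW' (WQ _ Wx) (WW' _ Wx)).
Qed.

(** If W were at a coarser level than Q, nestedness would also give Q inside W, hence Q = W, against
    the strict decay of volumes. In particular no set occurs at two levels, which justifies indexing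
    coefficients by sets. *)
Lemma cell_subset_level k j Q W : P k Q -> P j W -> W `<=` Q -> (k <= j)%N.
Proof.
move=> PQ PW WQ; rewrite leqNgt; apply/negP => jk.
have [x Wx] := cell_nonempty PW.
have QW := cell_nested (ltnW jk) PW PQ Wx (WQ _ Wx).
have EQ : Q = W by apply/seteqP.
have := vol_decay (ltnW jk) PW PQ QW; rewrite EQ.
have v0 := cell_vol_gt0 PW.
apply/negP; rewrite -ler_pdivrMr// divff ?gt_eqF// -ltNge.
by rewrite exprn_ilt1// subn_eq0 -ltnNge.
Qed.

Lemma cell_level_uniq k j W : P k W -> P j W -> k = j.
Proof.
move=> PkW PjW; apply/eqP; rewrite eqn_leq.
by rewrite (cell_subset_level PkW PjW)// (cell_subset_level PjW PkW).
Qed.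

Lemma vol_level k W : P k W -> vol W <= vol setT * l2 ^+ k.
Proof.
move=> PW; have P0 : P 0%N setT by rewrite (grid_0 gP).
by have := vol_decay (leq0n k) P0 PW (@subsetT _ W); rewrite subn0 mulrC.
Qed.

Lemma cell_exists k : (exists Q, P 0%N Q) -> exists Q, P k Q.
Proof.
move=> [Q PQ]; apply: contrapT => nW.
have := cell_vol_gt0 PQ; have := grid_cover gP k.
rewrite bigcup0 ?setC0; last by move=> W PW; exfalso; apply: nW; exists W.
by move: PQ; rewrite (grid_0 gP) /Defs.vol => -> ->; rewrite ltxx.
Qed.

End grid_geometry.

(** * Functions of a single level, written in canonical atoms *)

Section level_functions.
Context {R : realType} {d : measure_display} {T : measurableType d}.
Variables (m : {finite_measure set T -> \bar R}) (P : nat -> set (set T)).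
Hypothesis gP : good_grid m P.
Variable p : R.
Hypothesis p1 : 1 <= p.
Let p0 : 0 < p. Proof. exact: lt_le_trans p1. Qed.
Implicit Types (s : R) (c : set T -> R[i]) (k : nat).
Local Notation vol := (vol m).
Let fP := grid_finite gP.

Definition lsum s c k : T -> R[i] := level_sum P c (canonical_atom m s p) k.

Lemma lsumE s c k x :
  lsum s c k x = \sum_(W <- cells P k) c W * canonical_atom m s p W x.
Proof. by rewrite /lsum /level_sum fsum_cells. Qed.

Lemma canonical_atom_in s W x : W x ->
  canonical_atom m s p W x = ((vol W `^ (s - p^-1))%:C)%C.
Proof. by move=> Wx; rewrite /canonical_atom indicE mem_set// mulr1. Qed.

Lemma canonical_atom_out s W x : ~ W x -> canonical_atom m s p W x = 0.
Proof. by move=> Wx; rewrite /canonical_atom indicE memNset// mulr0. Qed.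

Lemma lsum_in s c k W x : P k W -> W x ->
  lsum s c k x = c W * ((vol W `^ (s - p^-1))%:C)%C.
Proof.
move=> PW Wx; rewrite lsumE (bigD1_seq W)/=; last exact: cells_uniq.
  rewrite canonical_atom_in// big_seq_cond big1 ?addr0// => Q /andP[/(cellsP fP) PQ QW].
  rewrite canonical_atom_out ?mulr0// => Qx.
  by move/eqP : QW; apply; exact: (cell_disjoint gP PQ PW Qx Wx).
exact/cellsP.
Qed.

Lemma lsum_out s c k x : (forall W, P k W -> ~ W x) -> lsum s c k x = 0.
Proof.
move=> nx; rewrite lsumE big_seq big1// => W /(cellsP fP) PW.
by rewrite canonical_atom_out ?mulr0//; exact: nx.
Qed.

Lemma measurable_canonical_atom s k W : P k W ->
  measurable_complex (canonical_atom m s p W).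
Proof.
move=> PW; apply: measurable_complex_real; apply: measurable_funM => //.
by apply: measurable_indic; exact: (grid_measurable gP PW).
Qed.

Lemma measurable_lsum s c k : measurable_complex (lsum s c k).
Proof.
have -> : lsum s c k =
    fun x => \sum_(W <- cells P k | W \in cells P k) c W * canonical_atom m s p W x.
  by apply/funext => x; rewrite lsumE big_seq.
apply: measurable_complex_sum => W /(cellsP fP) PW.
apply: measurable_complexM; first exact: measurable_complex_cst.
exact: (measurable_canonical_atom _ PW).
Qed.

Lemma lsum_sum (I : Type) (r : seq I) s (c : I -> set T -> R[i]) k x :
  lsum s (fun W => \sum_(i <- r) c i W) k x = \sum_(i <- r) lsum s (c i) k x.
Proof.
rewrite lsumE; under [RHS]eq_bigr do rewrite lsumE.
by rewrite exchange_big/=; apply: eq_bigr => W _; rewrite mulr_suml.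
Qed.

Lemma lsumB s (c c' : set T -> R[i]) k x :
  lsum s (fun W => c W - c' W) k x = lsum s c k x - lsum s c' k x.
Proof.
by rewrite !lsumE -sumrB; apply: eq_bigr => W _; rewrite mulrBl.
Qed.

Lemma eq_lsum s (c c' : set T -> R[i]) k x :
  (forall W, P k W -> c W = c' W) -> lsum s c k x = lsum s c' k x.
Proof.
move=> cc'; rewrite !lsumE; apply: eq_big_seq => W /(cellsP fP) PW.
by rewrite cc'.
Qed.

Lemma lsum_eq0 s c k x : (forall W, P k W -> c W = 0) -> lsum s c k x = 0.
Proof.
move=> c0; rewrite lsumE big_seq big1// => W /(cellsP fP) PW.
by rewrite c0// mul0r.
Qed.

(** The cells of a level are disjoint, so the p-th power is integrated cell by cell. Only cells with
    a nonzero coefficient enter the bound [V]; this allows a better [V] for coefficients supported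
    in a small cell. *)
Lemma LpNorm_lsum s c k (V : R) : 0 <= s -> 0 <= V ->
  (forall W, P k W -> c W != 0 -> vol W <= V) ->
  (LpNorm m p (lsum s c k) <= (V `^ s * lnorm P p c k)%:E)%E.
Proof.
move=> s0 V0 cV.
pose a W := normc (c W) * vol W `^ (s - p^-1).
have a0 W : 0 <= a W by rewrite mulr_ge0 ?normc_ge0 ?powR_ge0.
have pt x : normc (lsum s c k x) `^ p <=
    \sum_(W <- cells P k) a W `^ p * \1_W x.
  apply: (@le_trans _ _ ((\sum_(W <- cells P k) a W * \1_W x) `^ p)).
    rewrite ge0_ler_powR ?(ltW p0) ?nnegrE ?normc_ge0//.
      by apply: sumr_ge0 => W _; rewrite mulr_ge0.
    rewrite lsumE (le_trans (normc_sum _ _ _))//; apply: ler_sum => W _.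
    rewrite normcM /canonical_atom normc_real ger0_norm ?mulr_ge0 ?powR_ge0//.
    by rewrite mulrA.
  rewrite powR_sum_single//; last 2 first.
  - exact: cells_uniq.
  - move=> W W' /(cellsP fP) PW /(cellsP fP) PW'; rewrite !indicE.
    have [/set_mem Wx|] := boolP (x \in W); last by rewrite mulr0 eqxx.
    have [/set_mem Wx' _ _|] := boolP (x \in W'); last by rewrite mulr0 eqxx.
    exact: (cell_disjoint gP PW PW' Wx Wx').
  apply: ler_sum => W _; rewrite powRM//; rewrite indicE; case: (x \in W).
    by rewrite powR1.
  by rewrite powR0 ?gt_eqF.
have mL := measurable_normc (measurable_lsum s c k).
rewrite /LpNorm (Lnorm_integral m p (f := fun x => normc (lsum s c k x))); last first.
  by move=> x; exact: normc_ge0.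
have -> : V `^ s * lnorm P p c k = ((V `^ s * lnorm P p c k) `^ p) `^ p^-1.
  by rewrite -powRrM mulfV ?gt_eqF// powRr1// mulr_ge0 ?powR_ge0 ?lnorm_ge0.
rewrite -poweR_EFin gt0_ler_poweR ?invr_ge0 ?(ltW p0)// ?in_itv/= ?leey ?andbT ?lee_fin ?powR_ge0//.
  by apply: integral_ge0 => x _; rewrite lee_fin powR_ge0.
have mind W : W \in cells P k -> measurable_fun setT (fun x => (a W `^ p * \1_W x)%:E).
  move=> /(cellsP fP) PW; apply/measurable_EFinP; apply: measurable_funM => //.
  by apply: measurable_indic; exact: (grid_measurable gP PW).
apply: (@le_trans _ _
  (\int[m]_x (\sum_(W <- cells P k | W \in cells P k) (a W `^ p * \1_W x)%:E))%E).
  apply: ge0_le_integral => //.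
  - by move=> x _; rewrite lee_fin powR_ge0.
  - apply/measurable_EFinP.
    by apply: (@measurableT_comp _ _ _ _ _ _ (fun x => x `^ p)).
  - rewrite (_ : (fun x => _) =
       fun x => (\sum_(W <- cells P k) (if W \in cells P k then (a W `^ p * \1_W x)%:E else 0))%E).
      apply: emeasurable_sum => W.
      by have [/mind//|_] := boolP (W \in cells P k); exact: measurable_cst.
    by apply/funext => x; rewrite big_mkcond.
  - by move=> x _; rewrite -big_seq sumEFin lee_fin.
have -> : (\int[m]_x (\sum_(W <- cells P k | W \in cells P k) (a W `^ p * \1_W x)%:E) =
   \sum_(W <- cells P k | W \in cells P k) \int[m]_x (a W `^ p * \1_W x)%:E)%E.
  rewrite -[RHS]big_seq.
  (* Terms outside the level are set to zero because the exchange of sum and integral wants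
     measurability for every index, and only cells are known to be measurable. *)
  pose h W x := if W \in cells P k then (a W `^ p * \1_W x)%:E else 0%E.
  transitivity (\int[m]_x (\sum_(W <- cells P k) h W x))%E.
    apply: eq_integral => x _; rewrite -big_seq.
    by apply: eq_big_seq => W WE; rewrite /h WE.
  rewrite ge0_integral_sum//.
  - by apply: eq_big_seq => W WE; apply: eq_integral => x _; rewrite /h WE.
  - move=> W; rewrite /h.
    by have [/mind//|_] := boolP (W \in cells P k); exact: measurable_cst.
  - by move=> W x _; rewrite /h; case: ifP => // _; rewrite lee_fin mulr_ge0 ?powR_ge0.
rewrite powRM ?powR_ge0 ?lnorm_ge0// /lnorm lpn_powR// mulr_sumr -sumEFin.
rewrite [leRHS]big_seq; apply: lee_sum => W /(cellsP fP) PW.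
have mW := grid_measurable gP PW; have vW := cell_vol_gt0 gP PW.
under eq_integral do rewrite EFinM.
rewrite ge0_integralZl ?lee_fin ?powR_ge0//; last first.
  by apply/measurable_EFinP; exact: measurable_indic.
rewrite integral_indic// setIT -[X in (_ * X)%E](volK m mW) -EFinM lee_fin.
rewrite powRM ?normc_ge0 ?powR_ge0// mulrC mulrCA [leRHS]mulrC.
have [->|cW0] := eqVneq (c W) 0.
  by rewrite normc0 powR0 ?gt_eqF// !mul0r.
rewrite ler_wpM2l ?powR_ge0//.
(* Exponents: |W| times |W|^((s - 1/p) p) is |W|^(s p). *)
rewrite -powRrM -{1}(powRr1 (ltW vW)) -powRD; last by apply/implyP => _; rewrite gt_eqF.
rewrite mulrBl mulVf ?gt_eqF// addrCA subrr addr0 powRrM.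
by rewrite !ge0_ler_powR ?nnegrE ?powR_ge0 ?(ltW p0) ?(ltW vW) ?cV.
Qed.

End level_functions.

(** * Localization of expansions *)

Section localization.
Context {R : realType} {d : measure_display} {T : measurableType d}.
Variables (m : {finite_measure set T -> \bar R}) (P : nat -> set (set T)).
Hypothesis gP : good_grid m P.
Variable p : R.
Hypothesis p1 : 1 <= p.
Let p0 : 0 < p. Proof. exact: lt_le_trans p1. Qed.
Variables l1 l2 : R.
Hypotheses (l10 : 0 < l1) (l20 : 0 < l2) (l21 : l2 < 1).
Local Notation vol := (vol m).
Hypothesis ratio_lo : forall k Q Q', P k.+1 Q -> P k Q' -> Q `<=` Q' ->
  l1 * vol Q' <= vol Q.
Hypothesis ratio_hi : forall k Q Q', P k.+1 Q -> P k Q' -> Q `<=` Q' ->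
  vol Q <= l2 * vol Q'.
Let fP := grid_finite gP.
Local Notation N := (LpNorm m p).
Local Notation L := (lsum m P p).

(** The value of a Souza atom on its cell is at most the height of the canonical atom, so the ratio
    can be moved into the coefficient without increasing its modulus. *)
Lemma canonical_coefs s (c : set T -> R[i]) (a : set T -> T -> R[i]) :
  (forall k Q, P k Q -> souza_atom m s p Q (a Q)) ->
  exists2 c' : set T -> R[i], forall W, normc (c' W) <= normc (c W) &
    forall k x, level_sum P c a k x = L s c' k x.
Proof.
move=> sa.
have /choice[c' c'P] : forall W, exists z : R[i], normc z <= normc (c W) /\
    forall k x, P k W -> c W * a W x = z * canonical_atom m s p W x.
  move=> W; have [[k PW]|nW] := pselect (exists k, P k W); last first.
    exists 0; split; first by rewrite normc0 normc_ge0.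
    by move=> k x PW; exfalso; apply: nW; exists k.
  have [[z az] aout abnd] := sa k W PW.
  have [x0 Wx0] := cell_nonempty gP PW.
  have v0 : 0 < vol W `^ (s - p^-1) by rewrite powR_gt0// (cell_vol_gt0 gP PW).
  have vC0 : ((vol W `^ (s - p^-1))%:C)%C != 0 :> R[i].
    by rewrite -normc_eq0 normc_real normr_eq0 gt_eqF.
  exists (c W * z * ((vol W `^ (s - p^-1))^-1%:C)%C); split.
    rewrite !normcM normc_real ger0_norm ?invr_ge0 ?(ltW v0)// -mulrA.
    rewrite ler_piMr ?normc_ge0// ler_pdivrMr// mul1r -(az _ Wx0).
    exact: abnd.
  move=> j x _; have [Wx|Wx] := pselect (W x).
    rewrite canonical_atom_in// az// -mulrA -rmorphM mulVf ?gt_eqF//.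
    by rewrite rmorph1 mulr1.
  by rewrite canonical_atom_out// aout// !mulr0.
exists c' => [W|k x]; first by have [] := c'P W.
rewrite lsumE// /level_sum fsum_cells//; apply: eq_big_seq => W /(cellsP fP) PW.
by have [_ /(_ k x PW) ->] := c'P W.
Qed.

Lemma lsum_const s c j k Q x x' : (j <= k)%N -> P k Q -> Q x -> Q x' ->
  L s c j x = L s c j x'.
Proof.
move=> jk PQ Qx Qx'; have [W PW QW] := cell_ancestor gP jk PQ.
by rewrite !(lsum_in gP p s c PW)//; exact: QW.
Qed.

Lemma eq_lsum_at s c c' k x :
  (forall W, P k W -> W x -> c W = c' W) -> L s c k x = L s c' k x.
Proof.
move=> cc'; have [[W PW Wx]|nW] := pselect (exists2 W, P k W & W x).
  by rewrite !(lsum_in gP p s _ PW)// cc'.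
by rewrite !(lsum_out gP p)// => W PW Wx; apply: nW; exists W.
Qed.

Lemma LpNorm_indic (A : set T) : measurable A ->
  N (fun x => (\1_A x)%:C%C) = (m A `^ p^-1)%E.
Proof.
move=> mA; rewrite /LpNorm (Lnorm_integral m p (f := fun x => normc ((\1_A x)%:C%C))).
  congr poweR; under eq_integral => x _.
    have -> : normc ((\1_A x)%:C%C) `^ p = \1_A x :> R.
      rewrite normc_real indicE; case: (x \in A); first by rewrite normr1 powR1.
      by rewrite normr0 powR0// gt_eqF.
    over.
  by rewrite integral_indic// setIT.
by move=> x; exact: normc_ge0.
Qed.

(* The coarse part is a constant kappa on the parent Q^ of Q, and the fine part
   equals - kappa on Q^ \ Q, a set whose measure is comparable to that of Q. *)
Lemma coarse_part_bound (beta : R) k Q u y (M : R) : 0 < beta -> 0 <= M -> P k Q ->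
  measurable_complex u -> (forall x, ~ Q x -> u x = 0) ->
  Lp_cvg m p (fun n x => \sum_(0 <= j < n) L beta y j x) u ->
  (forall j, lnorm P p y j <= M) ->
  forall x, Q x ->
  normc (\sum_(0 <= j < k) L beta y j x) * vol Q `^ (p^-1 - beta) <=
  (l1^-1) `^ beta / ((1 - l2) `^ p^-1 * (1 - l2 `^ beta)) * M.
Proof.
move=> b0 M0 PQ mu uQ yu yM x0 Qx0.
have mu0 : 0 <= l2 `^ beta by exact: powR_ge0.
have mu1 : l2 `^ beta < 1.
  suff : l2 `^ beta < 1 `^ beta by rewrite powR1.
  by rewrite gt0_ltr_powR// nnegrE ltW.
have K1 : 0 < 1 - l2 `^ beta by rewrite subr_gt0.
have K2 : 0 < (1 - l2) `^ p^-1 by rewrite powR_gt0// subr_gt0.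
(* At level 0 there is no strictly larger cell and the coarse sum is empty; otherwise [Qh] is the
   parent, at level [k]. *)
case: k PQ => [|k] PQ.
  rewrite big_geq// normc0 mul0r mulr_ge0// divr_ge0 ?powR_ge0//.
  by rewrite mulr_ge0// ltW.
have [Qh PQh QQh] := grid_nested gP PQ.
have mQ := grid_measurable gP PQ; have mQh := grid_measurable gP PQh.
have vQ := cell_vol_gt0 gP PQ; have vQh := cell_vol_gt0 gP PQh.
pose B := Qh `\` Q; have mB : measurable B by exact: measurableD.
pose U n x := \sum_(0 <= j < n) L beta y j x.
set kap := \sum_(0 <= j < k.+1) L beta y j x0.
have kapE x : Qh x -> U k.+1 x = kap.
  move=> Qhx; rewrite /U /kap !big_nat; apply: eq_bigr => j /andP[_ jk].
  by rewrite (lsum_const beta y (x' := x0) (ltnSE jk) PQh)//; exact: QQh.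
(* On the parent only the cells inside it are seen. Dropping the others yields the factor |Qh|^beta
   instead of the volume of the whole space, which is what the scaling in |Q| demands. *)
pose yh W := if `[< W `<=` Qh >] then y W else 0.
have Lyh j : (N (L beta yh (k + j)%N) <= ((vol Qh `^ beta * M) * (l2 `^ beta) ^+ j)%:E)%E.
  have V0 : 0 <= l2 ^+ j * vol Qh by rewrite mulr_ge0 ?exprn_ge0 ?ltW.
  apply: le_trans (LpNorm_lsum gP p1 (ltW b0) V0 _) _.
    move=> W PW; rewrite /yh; case: asboolP => [WQh _|_]; last by rewrite eqxx.
    have := vol_decay gP (ltW l20) ratio_hi (leq_addr j k) PQh PW WQh.
    by rewrite addKn.
  rewrite lee_fin powRM ?exprn_ge0 ?(ltW l20) ?(ltW vQh)//.
  rewrite powR_exprn ?(ltW l20)//.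
  rewrite -mulrA mulrC ler_wpM2r ?exprn_ge0// ler_wpM2l ?powR_ge0//.
  apply: le_trans (yM (k + j)%N); apply: le_lpn => // W _.
  rewrite normc_ge0/= /yh; case: ifP => // _; rewrite normc0; exact: normc_ge0.
pose D := vol Qh `^ beta * M / (1 - l2 `^ beta).
have mL c j : measurable_complex (L beta c j) by exact: measurable_lsum.
have mU n : measurable_complex (U n) by exact: measurable_complex_sum.
have key : ((normc kap * vol B `^ p^-1)%:E <= D%:E)%E.
  apply/lee_addgt0Pr => e e0.
  have [|K HK] := (ereal_cvg0P _).1 yu _ e0.
    by move=> n; exact: LpNorm_ge0.
  pose n := maxn k.+1 K.
  have kn : (k < n)%N by rewrite /n leq_max leqnn.
  have -> : ((normc kap * vol B `^ p^-1)%:E = N (fun x => kap * (\1_B x)%:C%C)%R)%E.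
    rewrite LpNormZ//; last exact: measurable_complex_indic.
    by rewrite LpNorm_indic// -[X in (X `^ _)%E](volK m mB) poweR_EFin EFinM.
  (* Index [k] carries the approximation error and the indices above it the fine levels, so that one
     domination bounds [kap] on [B], where [u] vanishes. *)
  pose v j := if (j <= k)%N then (fun x => u x - U n x) else L beta yh j.
  have mv j : measurable_complex (v j).
    rewrite /v; case: leqP => _ //; exact: measurable_complexB.
  apply: (@le_trans _ _ (\sum_(k <= j < n) N (v j))%E).
    apply: LpNorm_sum_dom => //.
      apply: measurable_complexM; first exact: measurable_complex_cst.
      exact: measurable_complex_indic.
    move=> x; rewrite normcM normc_real indicE.
    have [/set_mem[Qhx Qx]|_] := boolP (x \in B); last first.
      by rewrite normr0 mulr0; apply: sumr_ge0 => j _; exact: normc_ge0.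
    rewrite normr1 mulr1 big_ltn// {1}/v leqnn uQ// sub0r normcN.
    have -> : \sum_(k.+1 <= j < n) normc (v j x) =
        \sum_(k.+1 <= j < n) normc (L beta y j x).
      rewrite !big_nat; apply: eq_bigr => j /andP[kj _].
      rewrite /v leqNgt kj/=; congr normc; apply: eq_lsum_at => W PW Wx.
      rewrite /yh; case: asboolP => // []; case.
      exact: (cell_nested gP (ltnW kj) PQh PW Qhx Wx).
    have -> : kap = U n x - \sum_(k.+1 <= j < n) L beta y j x.
      rewrite -(kapE x Qhx); apply/esym/eqP; rewrite subr_eq; apply/eqP.
      by rewrite /U (@big_cat_nat _ _ _ k.+1).
    by rewrite (le_trans (normcD _ _))// lerD2l normcN normc_sum.
  rewrite big_ltn// addeC; apply: leeD.
    have -> : (\sum_(k.+1 <= j < n) N (v j) =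
       \sum_(0 <= j < n - k.+1) N (L beta yh (k + j.+1)%N))%E.
      rewrite -{1}(add0n k.+1) big_addn; apply: eq_bigr => j _.
      by rewrite addnC addSnnS /v leqNgt addnS ltnS leq_addr.
    apply: (@le_trans _ _ (\sum_(0 <= j < n - k.+1)
        ((vol Qh `^ beta * M) * (l2 `^ beta) ^+ j)%:E)%E).
      apply: lee_sum => j _; apply: le_trans (Lyh _) _; rewrite lee_fin.
      rewrite ler_wpM2l ?mulr_ge0 ?powR_ge0// exprS ler_piMl ?exprn_ge0//.
      exact: ltW.
    rewrite sumEFin lee_fin -mulr_sumr ler_wpM2l ?mulr_ge0 ?powR_ge0//.
    by rewrite big_mkord sum_expr_le.
  by rewrite /v leqnn; apply: HK; rewrite /n leq_maxr.
(* The upper ratio leaves at least the fraction 1 - l2 of the parent outside Q, and the parent is at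
   least as large as Q. *)
have vB : (1 - l2) * vol Q <= vol B.
  have : vol Qh = vol Q + vol B.
    apply: EFin_inj; rewrite EFinD !volK//.
    rewrite -measureU//; last first.
      by apply/seteqP; split => x // [Qx [_ nQx]]; exact: nQx.
    by rewrite /B setDUK.
  have := ratio_hi PQ PQh QQh.
  have : vol Q <= vol Qh by apply: le_vol.
  move: vQ vQh l20 l21; nra.
(* The lower ratio converts the volume of the parent into that of Q; this is the origin of the
   factor (1/l1)^beta. *)
have vQhQ : vol Qh <= l1^-1 * vol Q.
  by rewrite -ler_pdivrMl ?invr_gt0// invrK; exact: (ratio_lo PQ PQh QQh).
move: key; rewrite lee_fin => key.
have H : normc kap * ((1 - l2) `^ p^-1 * vol Q `^ p^-1) <=
    (l1^-1) `^ beta * vol Q `^ beta * M / (1 - l2 `^ beta).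
  have l210 : 0 <= 1 - l2 by rewrite subr_ge0 ltW.
  apply: (@le_trans _ _ (normc kap * vol B `^ p^-1)).
    rewrite ler_wpM2l ?normc_ge0// -powRM ?(ltW vQ)//.
    by rewrite ge0_ler_powR ?invr_ge0 ?(ltW p0) ?nnegrE ?vol_ge0// mulr_ge0// ltW.
  apply: le_trans key _; rewrite /D ler_wpM2r ?invr_ge0 ?(ltW K1)//.
  rewrite ler_wpM2r// -powRM ?invr_ge0 ?(ltW l10) ?(ltW vQ)//.
  by rewrite ge0_ler_powR ?(ltW b0) ?nnegrE ?vol_ge0// mulr_ge0 ?invr_ge0 ?(ltW l10) ?(ltW vQ).
rewrite powRB; last by apply/implyP => _; rewrite gt_eqF.
have vb0 : 0 < vol Q `^ beta by rewrite powR_gt0.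
rewrite mulrA ler_pdivrMr//.
rewrite -(ler_pM2l K2); apply: le_trans (le_trans _ H) _.
  by rewrite mulrCA mulrA.
rewrite le_eqVlt; apply/orP; left; apply/eqP.
by field; rewrite !gt_eqF.
Qed.

End localization.

Section local_expansion.
Context {R : realType} {d : measure_display} {T : measurableType d}.
Variables (m : {finite_measure set T -> \bar R}) (P : nat -> set (set T)).
Hypothesis gP : good_grid m P.
Variable p : R.
Hypothesis p1 : 1 <= p.
Let p0 : 0 < p. Proof. exact: lt_le_trans p1. Qed.
Variables l1 l2 : R.
Hypotheses (l10 : 0 < l1) (l20 : 0 < l2) (l21 : l2 < 1).
Local Notation vol := (vol m).
Hypothesis ratio_lo : forall k Q Q', P k.+1 Q -> P k Q' -> Q `<=` Q' ->
  l1 * vol Q' <= vol Q.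
Hypothesis ratio_hi : forall k Q Q', P k.+1 Q -> P k Q' -> Q `<=` Q' ->
  vol Q <= l2 * vol Q'.
Let fP := grid_finite gP.
Local Notation N := (LpNorm m p).
Local Notation L := (lsum m P p).
Variable beta : R.
Hypothesis b0 : 0 < beta.

(** The 1 accounts for the coefficients already present. The fraction is the constant of
    [coarse_part_bound]: 1/l1 compares parent and cell, (1 - l2)^(1/p) measures the parent outside
    the cell, and 1 - l2^beta sums the fine levels. *)
Definition local_const : R :=
  1 + (l1^-1) `^ beta / ((1 - l2) `^ p^-1 * (1 - l2 `^ beta)).

Lemma decay_lt1 b : 0 < b -> l2 `^ b < 1.
Proof.
move=> bp; suff : l2 `^ b < 1 `^ b by rewrite powR1.
by rewrite gt0_ltr_powR// nnegrE ltW.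
Qed.

Lemma local_const_ge1 : 1 <= local_const.
Proof.
rewrite lerDl divr_ge0 ?powR_ge0// mulr_ge0 ?powR_ge0//.
by rewrite subr_ge0 ltW// decay_lt1.
Qed.

Lemma LpNorm_lsum_level s c k : 0 <= s ->
  (N (L s c k) <= ((vol setT `^ s * lnorm P p c k) * (l2 `^ s) ^+ k)%:E)%E.
Proof.
move=> s0; have V0 : 0 <= vol setT * l2 ^+ k.
  by rewrite mulr_ge0 ?vol_ge0// exprn_ge0 ?ltW.
apply: le_trans (LpNorm_lsum gP p1 s0 V0 _) _.
  by move=> W PW _; exact: (vol_level gP (ltW l20) ratio_hi PW).
by rewrite lee_fin powRM ?vol_ge0 ?exprn_ge0 ?(ltW l20)// powR_exprn ?(ltW l20)// mulrAC.
Qed.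

(** Cells not inside Q are discarded and the coefficient of Q takes over everything that levels up
    to k contribute on Q. From level k on, the new partial sums are the old ones times the indicator
    of Q; nothing is lost, since [u] vanishes outside Q. *)
Lemma localize k Q u y M : 0 <= M -> P k Q ->
  measurable_complex u -> (forall x, ~ Q x -> u x = 0) ->
  Lp_cvg m p (fun n x => \sum_(0 <= j < n) L beta y j x) u ->
  (forall j, lnorm P p y j <= M) ->
  exists y' : set T -> R[i], [/\ forall W, y' W != 0 -> W `<=` Q,
    forall j, lnorm P p y' j <= local_const * M &
    Lp_cvg m p (fun n x => \sum_(0 <= j < n) L beta y' j x) u].
Proof.
move=> M0 PQ mu uQ yu yM.
have [x0 Qx0] := cell_nonempty gP PQ.
have vQ := cell_vol_gt0 gP PQ.
have coarse := coarse_part_bound gP p1 l10 l20 l21 ratio_lo ratio_hi b0 M0 PQ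
  mu uQ yu yM Qx0.
pose U n x := \sum_(0 <= j < n) L beta y j x.
(* The constant value on Q of the levels 0 to k, divided by the height of the canonical atom of
   Q. *)
pose kap := U k.+1 x0 * ((vol Q `^ (p^-1 - beta))%:C)%C.
pose y' W := if W == Q then kap else if `[< W `<=` Q >] then y W else 0.
have y'Q W : y' W != 0 -> W `<=` Q.
  rewrite /y'; case: (W =P Q) => [-> _ //|_].
  by case: asboolP => // _; rewrite eqxx.
have lower j W : (j < k)%N -> P j W -> y' W = 0.
  move=> jk PW; apply/eqP/negPn/negP => /y'Q WQ.
  by have := cell_subset_level gP (ltW l20) l21 ratio_hi PQ PW WQ; rewrite leqNgt jk.
have vV : vol Q `^ (p^-1 - beta) * vol Q `^ (beta - p^-1) = 1.
  by rewrite -powRD ?addrA ?subrK ?subrr ?powRr0//; apply/implyP => _; rewrite gt_eqF.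
have mL c j : measurable_complex (L beta c j) by exact: measurable_lsum.
have mU n : measurable_complex (U n) by exact: measurable_complex_sum.
have kapM : normc kap <= local_const * M.
  rewrite normcM normc_real ger0_norm ?powR_ge0//.
  rewrite /U big_nat_recr//= (le_trans (ler_wpM2r _ (normcD _ _))) ?powR_ge0//.
  rewrite mulrDl /local_const mulrDl mul1r addrC lerD//.
  rewrite (lsum_in gP p beta y PQ Qx0) normcM normc_real ger0_norm ?powR_ge0//.
  rewrite -mulrA [X in _ * X]mulrC vV mulr1.
  apply: le_trans (yM k).
  apply: (coord_le_lpn (x := fun W => normc (y W))) => //; last exact: normc_ge0.
  exact/cellsP.
exists y'; split=> //.
- move=> j; have lM : M <= local_const * M.
    by rewrite ler_peMl// local_const_ge1.
  have [->|jk] := eqVneq j k.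
    apply: le_trans kapM; apply: le_lpn_sum; rewrite ?normc_ge0//.
    rewrite (bigD1_seq Q)/=; [|exact/cellsP|exact: cells_uniq].
    rewrite {1}/y' eqxx big_seq_cond big1 ?addr0// => W /andP[/(cellsP fP) PW WQ].
    rewrite /y' (negPf WQ); case: asboolP => [sWQ|_]; last first.
      by rewrite normc0 powR0// gt_eqF.
    have [x Wx] := cell_nonempty gP PW.
    by move/eqP: WQ; case; exact: (cell_disjoint gP PW PQ Wx (sWQ _ Wx)).
  apply: le_trans lM; apply: le_trans (yM j); apply: le_lpn => // W /(cellsP fP) PW.
  rewrite normc_ge0/= /y'; case: eqP => [WQ|_].
    rewrite WQ in PW; have := cell_level_uniq gP (ltW l20) l21 ratio_hi PW PQ.
    by move=> jkE; rewrite jkE eqxx in jk.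
  by case: asboolP => // _; rewrite normc0 normc_ge0.
have U'E n x : (k < n)%N -> \sum_(0 <= j < n) L beta y' j x = (\1_Q x)%:C%C * U n x.
  move=> kn; rewrite indicE; have [/set_mem Qx|/negP nQx] := boolP (x \in Q); last first.
    rewrite mul0r big1// => j _.
    rewrite -[RHS](lsum_eq0 gP p beta (c := fun=> 0) (k := j) x)//.
    apply: (eq_lsum_at gP) => W PW Wx; apply/eqP/negPn/negP => /y'Q /(_ _ Wx) Qx.
    by apply: nQx; exact: mem_set.
  rewrite mul1r /U (@big_cat_nat _ _ _ k.+1)//= [RHS](@big_cat_nat _ _ _ k.+1)//=.
  congr (_ + _); last first.
    rewrite !big_nat; apply: eq_bigr => j /andP[kj _]; apply: (eq_lsum_at gP) => W PW Wx.
    rewrite /y'; case: eqP => [WQ|_].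
      rewrite WQ in PW; have := cell_level_uniq gP (ltW l20) l21 ratio_hi PW PQ.
      by move=> jkE; rewrite jkE ltnn in kj.
    by case: asboolP => // []; case; exact: (cell_nested gP (ltnW kj) PQ PW Qx Wx).
  rewrite big_nat_recr//= big_nat big1 ?add0r; last first.
    by move=> j /andP[_ jk]; apply: (lsum_eq0 gP) => W PW; exact: (lower j).
  rewrite (lsum_in gP p beta y' PQ Qx) {1}/y' eqxx /kap -mulrA -rmorphM/= vV rmorph1 mulr1.
  rewrite /U !big_nat; apply: eq_bigr => j /andP[_ jk].
  exact: (lsum_const gP p beta y (ltnSE jk) PQ Qx0 Qx).
(* The identity [U'E] is available for n > k only; for the finitely many other n the sequence is
   compared with itself. *)
apply: (ereal_squeeze0 (b := fun n => if (k < n)%N then N (fun x => u x - U n x)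
  else N (fun x => u x - \sum_(0 <= j < n) L beta y' j x))).
- by move=> n; exact: LpNorm_ge0.
- move=> n; case: ifPn => // kn.
  apply: LpNorm_dom => //.
  + apply: measurable_complexB => //; exact: measurable_complex_sum.
  + exact: measurable_complexB.
  move=> x; rewrite U'E// indicE; have [/set_mem Qx|/negP nQx] := boolP (x \in Q).
    by rewrite mul1r.
  rewrite mul0r subr0 uQ ?normc0 ?normc_ge0// => Qx.
  by apply: nQx; exact: mem_set.
- apply/ereal_cvg0P => [n|e e0]; first by case: ifP => _; exact: LpNorm_ge0.
  have [|K HK] := (ereal_cvg0P _).1 yu _ e0.
    by move=> n; exact: LpNorm_ge0.
  exists (maxn k.+1 K) => n; rewrite geq_max => /andP[kn Kn]; rewrite kn.
  exact: HK.
Qed.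

(** Every level norm is at most the cost, whatever the exponent. This uniform bound and the
    convergence in L^p are all that localization takes from a representation. *)
Lemma repr_canonical s q g c a : (1 <= q)%E ->
  representation m P s p q g c a ->
  exists c' : set T -> R[i], [/\ forall W, normc (c' W) <= normc (c W),
   (forall j, ((lnorm P p c' j)%:E <= cost P p q c)%E) &
   Lp_cvg m p (fun n x => \sum_(0 <= k < n) L s c' k x) g].
Proof.
move=> q1 [_ ra _ rs _]; have [c' c'c c'E] := canonical_coefs gP c ra.
exists c'; split=> // [j|].
  rewrite cost_lqcost//; apply: (@le_trans _ _ (lnorm P p c j)%:E).
    rewrite lee_fin; apply: le_lpn => // W _.
    by rewrite normc_ge0 c'c.
  by apply: level_le_lqcost => // k; exact: lnorm_ge0.
apply: eq_Lp_cvg rs => //; exists 0%N => n x _.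
by apply: eq_bigr => k _; rewrite c'E.
Qed.

(** The infimum need not be attained. For M > 0 a representation of cost below 2M exists and is
    localized, whence the factor 2. For M = 0 the function is null almost everywhere and zero
    coefficients serve. *)
Lemma besov_norm_local q k Q u M : (1 <= q)%E -> 0 <= M -> P k Q ->
  (forall x, ~ Q x -> u x = 0) -> (besov_norm m P beta p q u <= M%:E)%E ->
  exists y : set T -> R[i], [/\ forall W, y W != 0 -> W `<=` Q,
    forall j, lnorm P p y j <= 2 * local_const * M &
    Lp_cvg m p (fun n x => \sum_(0 <= j < n) L beta y j x) u].
Proof.
move=> q1 M0 PQ uQ uM.
have approx e : M < e -> measurable_complex u /\ exists c' : set T -> R[i],
    (forall j, lnorm P p c' j <= e) /\
    Lp_cvg m p (fun n x => \sum_(0 <= k < n) L beta c' k x) u.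
  move=> Me; have : (besov_norm m P beta p q u < e%:E)%E.
    by rewrite (le_lt_trans uM)// lte_fin.
  move=> /ereal_inf_lt[_ [c [a [rep ->]]] ce].
  split; first by case: (repr_Lp rep).
  have [c' [_ c'c c'u]] := repr_canonical q1 rep.
  by exists c'; split=> // j; rewrite -lee_fin (le_trans (c'c j))// ltW.
have [M00|Mpos] := eqVneq M 0; last first.
  have {}Mpos : 0 < M by rewrite lt0r Mpos M0.
  have [|mu [c' [c'M c'u]]] := approx (2 * M); first by rewrite ltr_pMl// ltr1n.
  have M20 : 0 <= 2 * M by rewrite mulr_ge0.
  have [y [y1 y2 y3]] := localize M20 PQ mu uQ c'u c'M.
  by exists y; split=> // j; rewrite -mulrA mulrCA.
have mu : measurable_complex u by case: (approx 1) => //; rewrite M00.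
(* For each [e] an expansion with level norms at most e/(1 + B) exists; its levels sum geometrically
   with total factor [B], so the norm of [u] is at most [e]. *)
have Nu0 : N u = 0%E.
  have K0 : 0 < 1 - l2 `^ beta by rewrite subr_gt0 decay_lt1.
  have B0 : 0 <= vol setT `^ beta / (1 - l2 `^ beta).
    by rewrite divr_ge0 ?powR_ge0 ?ltW.
  apply/eqP; rewrite eq_le LpNorm_ge0 andbT; apply/lee_addgt0Pr => e e0.
  rewrite add0e; set B := vol setT `^ beta / (1 - l2 `^ beta) in B0.
  have e'0 : 0 < e / (1 + B) by rewrite divr_gt0// ltr_pwDl.
  have [|_ [c' [c'M c'u]]] := approx (e / (1 + B)); first by rewrite M00.
  have V0 : 0 <= vol setT `^ beta * (e / (1 + B)) by rewrite mulr_ge0 ?powR_ge0// ltW.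
  have := @Lp_tail _ _ _ m p p1 (L beta c') u (fun=> 1) 0 _ (l2 `^ beta) mu
    (measurable_complex_cst 1) (fun k => measurable_lsum gP p beta c' k) V0
    (powR_ge0 _ _) (decay_lt1 b0) c'u.
  rewrite (eq_LpNorm m p (v := u)); last by move=> x; rewrite mul1r big_geq// subr0.
  move=> /(_ _)/le_trans; apply => [j|]; last first.
    rewrite lee_fin mulrAC -/B mulrA ler_pdivrMr ?ltr_pwDl// mulrC ler_wpM2l ?(ltW e0)//.
    by rewrite lerDr.
  rewrite addn0 (eq_LpNorm m p (v := L beta c' j)); last by move=> x; rewrite mul1r.
  apply: le_trans (LpNorm_lsum_level _ _ (ltW b0)) _; rewrite lee_fin.
  by rewrite ler_wpM2r ?exprn_ge0 ?powR_ge0// ler_wpM2l ?powR_ge0.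
exists (fun=> 0); split.
- by move=> W; rewrite eqxx.
- move=> j; rewrite M00 mulr0 /lnorm; under eq_lpn => W _ do rewrite normc0.
  by rewrite lpn0.
apply/ereal_cvg0P => [n|e e0]; first exact: LpNorm_ge0.
exists 0%N => n _; rewrite (eq_LpNorm m p (v := u)) ?Nu0 ?lee_fin ?ltW// => x.
by rewrite big1 ?subr0// => j _; exact: (lsum_eq0 gP).
Qed.

End local_expansion.

(** * Reassembling the expansions *)

Section reassembly.
Context {R : realType} {d : measure_display} {T : measurableType d}.
Variables (m : {finite_measure set T -> \bar R}) (P : nat -> set (set T)).
Hypothesis gP : good_grid m P.
Variable p : R.
Hypothesis p1 : 1 <= p.
Let p0 : 0 < p. Proof. exact: lt_le_trans p1. Qed.
Variables l2 s beta : R.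
Hypotheses (l20 : 0 < l2) (l21 : l2 < 1) (s0 : 0 < s) (sb : s < beta).
Local Notation vol := (vol m).
Hypothesis ratio_hi : forall k Q Q', P k.+1 Q -> P k Q' -> Q `<=` Q' ->
  vol Q <= l2 * vol Q'.
Let fP := grid_finite gP.
Local Notation L := (lsum m P p).
Local Notation th := (l2 `^ (beta - s)).
Implicit Types (sigma : set T -> set T -> R[i]) (c : set T -> R[i]).

Let th0 : 0 <= th. Proof. exact: powR_ge0. Qed.

Let th1 : th < 1. Proof. by apply: decay_lt1 => //; rewrite subr_gt0. Qed.

Definition reweight Q W : R := (vol W / vol Q) `^ (beta - s).

(* When c Q is the coefficient of f at Q, and g times the canonical beta-atom
   of Q has the coefficients sigma Q, the product of g and the k-th level of f
   has the coefficients relevel c k sigma with respect to canonical s-atoms. *)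
Definition relevel c k sigma W : R[i] :=
  \sum_(Q <- cells P k) c Q * ((reweight Q W)%:C)%C * sigma Q W.

(** Coefficients are indexed by sets, so the level at which the sum in [reassemble] stops has to be
    recovered from W. The value 0 off the grid is a dummy. *)
Definition cell_level W : nat := xget 0%N [set k | P k W].

Definition reassemble c sigma W : R[i] :=
  \sum_(0 <= k < (cell_level W).+1) relevel c k sigma W.

Lemma cell_levelE k W : P k W -> cell_level W = k.
Proof.
move=> PW; rewrite /cell_level; case: xgetP => [j _ PjW|/(_ k)//].
exact: (cell_level_uniq gP (ltW l20) l21 ratio_hi PjW PW).
Qed.

Lemma reassembleE c sigma k W : P k W ->
  reassemble c sigma W = \sum_(0 <= l < k.+1) relevel c l sigma W.
Proof. by move=> PW; rewrite /reassemble (cell_levelE PW). Qed.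

Lemma relevel_sum (I : Type) (r : seq I) c k (sigma : I -> set T -> set T -> R[i]) W :
  relevel c k (fun Q W => \sum_(i <- r) sigma i Q W) W =
  \sum_(i <- r) relevel c k (sigma i) W.
Proof.
by rewrite exchange_big/=; apply: eq_bigr => Q _; rewrite mulr_sumr.
Qed.

Lemma reassemble_sum (I : Type) (r : seq I) c (sigma : I -> set T -> set T -> R[i]) W :
  reassemble c (fun Q W => \sum_(i <- r) sigma i Q W) W =
  \sum_(i <- r) reassemble c (sigma i) W.
Proof.
by rewrite exchange_big/=; apply: eq_bigr => k _; rewrite relevel_sum.
Qed.

Lemma relevelB c k sigma tau W :
  relevel c k (fun Q W => sigma Q W - tau Q W) W =
  relevel c k sigma W - relevel c k tau W.
Proof. by rewrite -sumrB; apply: eq_bigr => Q _; rewrite mulrBr. Qed.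

Lemma reassembleB c sigma tau W :
  reassemble c (fun Q W => sigma Q W - tau Q W) W =
  reassemble c sigma W - reassemble c tau W.
Proof. by rewrite -sumrB; apply: eq_bigr => k _; rewrite relevelB. Qed.

Definition cell_supported sigma := forall Q W, sigma Q W != 0 -> W `<=` Q.

Lemma relevel_coarse c k sigma j W : cell_supported sigma -> (j < k)%N ->
  P j W -> relevel c k sigma W = 0.
Proof.
move=> ss jk PW; rewrite /relevel big_seq big1// => Q /(cellsP fP) PQ.
have [->|/ss WQ] := eqVneq (sigma Q W) 0; first by rewrite mulr0.
by have := cell_subset_level gP (ltW l20) l21 ratio_hi PQ PW WQ; rewrite leqNgt jk.
Qed.

(** A cell W has only one ancestor at level k, so the p-th power passes inside the sum over Q. The
    two sums are then exchanged, and volume decay bounds the weight by th^(j - k). *)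
Lemma lnorm_relevel c k sigma (B : R) j : cell_supported sigma -> 0 <= B ->
  (forall Q j, lnorm P p (sigma Q) j <= B) -> (k <= j)%N ->
  lnorm P p (relevel c k sigma) j <= th ^+ (j - k) * (B * lnorm P p c k).
Proof.
move=> ss B0 sB kj.
have t0 : 0 <= th ^+ (j - k) by rewrite exprn_ge0.
apply: le_lpn_sum => //; first by rewrite !mulr_ge0// lnorm_ge0.
pose y Q W := normc (c Q) * reweight Q W * normc (sigma Q W).
have y0 Q W : 0 <= y Q W by rewrite !mulr_ge0 ?normc_ge0 ?powR_ge0.
apply: (@le_trans _ _ (\sum_(W <- cells P j) \sum_(Q <- cells P k) y Q W `^ p)).
  rewrite !big_seq; apply: ler_sum => W /(cellsP fP) PW.
  apply: (@le_trans _ _ ((\sum_(Q <- cells P k) y Q W) `^ p)).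
    rewrite ge0_ler_powR ?(ltW p0) ?nnegrE ?normc_ge0//.
      by apply: sumr_ge0.
    rewrite /relevel (le_trans (normc_sum _ _ _))//; apply: ler_sum => Q _.
    by rewrite !normcM normc_real ger0_norm ?powR_ge0.
  rewrite powR_sum_single//; first exact: cells_uniq.
  move=> Q Q' /(cellsP fP) PQ /(cellsP fP) PQ' yQ yQ'.
  have sub Q1 : y Q1 W != 0 -> W `<=` Q1.
    move=> yQ1; apply: ss; apply: contra yQ1 => /eqP sQ1.
    by rewrite /y sQ1 normc0 mulr0.
  have [x Wx] := cell_nonempty gP PW.
  exact: (cell_disjoint gP PQ PQ' (sub _ yQ _ Wx) (sub _ yQ' _ Wx)).
rewrite exchange_big/=.
have E : (th ^+ (j - k) * (B * lnorm P p c k)) `^ p =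
    \sum_(Q <- cells P k) (th ^+ (j - k) * (B * normc (c Q))) `^ p.
  rewrite powRM ?mulr_ge0 ?lnorm_ge0// powRM ?lnorm_ge0//.
  rewrite /lnorm lpn_powR// !mulr_sumr; apply: eq_bigr => Q _.
  by rewrite [in RHS]powRM ?mulr_ge0 ?normc_ge0// powRM ?normc_ge0.
rewrite E big_seq [leRHS]big_seq; apply: ler_sum => Q /(cellsP fP) PQ.
have v0 := cell_vol_gt0 gP PQ.
apply: (@le_trans _ _ (\sum_(W <- cells P j)
    ((th ^+ (j - k) * normc (c Q)) * normc (sigma Q W)) `^ p)).
  rewrite !big_seq; apply: ler_sum => W /(cellsP fP) PW.
  rewrite ge0_ler_powR ?(ltW p0) ?nnegrE//.
    by rewrite !mulr_ge0 ?normc_ge0.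
  rewrite /y; have [->|/ss WQ] := eqVneq (sigma Q W) 0.
    by rewrite normc0 !mulr0.
  rewrite ler_wpM2r ?normc_ge0// mulrC ler_wpM2r ?normc_ge0//.
  rewrite -powR_exprn ?(ltW l20)// /reweight.
  rewrite ge0_ler_powR ?subr_ge0 ?(ltW sb) ?nnegrE ?exprn_ge0 ?(ltW l20)//.
    by rewrite divr_ge0 ?vol_ge0.
  rewrite ler_pdivrMr//.
  exact: (vol_decay gP (ltW l20) ratio_hi kj PQ PW WQ).
have -> : \sum_(W <- cells P j) (th ^+ (j - k) * normc (c Q) * normc (sigma Q W)) `^ p =
    (th ^+ (j - k) * normc (c Q) * lnorm P p (sigma Q) j) `^ p.
  rewrite powRM ?mulr_ge0 ?normc_ge0 ?lnorm_ge0// /lnorm lpn_powR// mulr_sumr.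
  by apply: eq_bigr => W _; rewrite powRM ?mulr_ge0 ?normc_ge0.
rewrite ge0_ler_powR ?(ltW p0) ?nnegrE ?mulr_ge0 ?normc_ge0 ?lnorm_ge0//.
by rewrite -mulrA ler_wpM2l// mulrC ler_wpM2r ?normc_ge0.
Qed.

(** The triangle inequality over the ancestor level k, reindexed by the depth l = j - k, produces
    the convolution that [lqcost_conv] expects. *)
Lemma lnorm_reassemble c sigma (B : R) j : cell_supported sigma -> 0 <= B ->
  (forall Q j, lnorm P p (sigma Q) j <= B) ->
  lnorm P p (reassemble c sigma) j <=
    B * \sum_(l < j.+1) th ^+ l * lnorm P p c (j - l)%N.
Proof.
move=> ss B0 sB.
apply: (@le_trans _ _ (lpn (cells P j) p
    (fun W => \sum_(0 <= k < j.+1) normc (relevel c k sigma W)))).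
  apply: le_lpn => // W /(cellsP fP) PW.
  by rewrite normc_ge0/= (reassembleE c sigma PW) normc_sum.
apply: le_trans (lpn_sum _ _ _) _ => //.
  by move=> k W _; exact: normc_ge0.
rewrite big_mkord (reindex_inj rev_ord_inj)/= mulr_sumr.
apply: ler_sum => l _; rewrite subSS.
apply: le_trans (lnorm_relevel c ss B0 sB (leq_subr l j)) _.
by rewrite subKn ?leq_ord// mulrCA.
Qed.

Lemma lnorm_reassemble_bounded c sigma (B X : R) j : cell_supported sigma -> 0 <= B ->
  (forall Q j, lnorm P p (sigma Q) j <= B) -> (forall k, lnorm P p c k <= X) ->
  lnorm P p (reassemble c sigma) j <= B * X / (1 - th).
Proof.
move=> ss B0 sB cX; apply: le_trans (lnorm_reassemble c j ss B0 sB) _.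
rewrite -mulrA ler_wpM2l//.
apply: (@le_trans _ _ (\sum_(l < j.+1) th ^+ l * X)).
  by apply: ler_sum => l _; rewrite ler_wpM2l// exprn_ge0.
rewrite -mulr_suml mulrC ler_wpM2l ?sum_expr_le//.
by apply: le_trans (cX 0%N); exact: lnorm_ge0.
Qed.

(** The factor c_Q |Q|^(s - beta) is the coefficient of f with respect to the canonical beta-atom of
    Q; the weight [reweight] turns the beta-atom of W back into an s-atom. *)
Lemma lsum_relevel c k sigma j x :
  L s (relevel c k sigma) j x =
  \sum_(Q <- cells P k) (c Q * ((vol Q `^ (s - beta))%:C)%C) * L beta (sigma Q) j x.
Proof.
have [[W PW Wx]|nW] := pselect (exists2 W, P j W & W x); last first.
  have out W : P j W -> ~ W x by move=> PW Wx; apply: nW; exists W.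
  rewrite (lsum_out gP p s _ out) big1// => Q _.
  by rewrite (lsum_out gP p beta _ out) mulr0.
rewrite (lsum_in gP p s _ PW Wx) /relevel mulr_suml.
apply: eq_big_seq => Q /(cellsP fP) PQ; rewrite (lsum_in gP p beta _ PW Wx).
have vQ := cell_vol_gt0 gP PQ; have vW := cell_vol_gt0 gP PW.
have E : reweight Q W * vol W `^ (s - p^-1) =
    vol Q `^ (s - beta) * vol W `^ (beta - p^-1).
  rewrite /reweight powRM ?invr_ge0 ?(ltW vQ) ?(ltW vW)//.
  rewrite -(powR_inv1 (ltW vQ)) -powRrM mulrAC -powRD; last first.
    by apply/implyP => _; rewrite gt_eqF.
  by rewrite mulN1r opprB addrA subrK mulrC.
have EC : ((reweight Q W)%:C * (vol W `^ (s - p^-1))%:C =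
    (vol Q `^ (s - beta))%:C * (vol W `^ (beta - p^-1))%:C)%C.
  by rewrite -!rmorphM/= E.
rewrite -2!mulrA [sigma Q W * _]mulrC [X in c Q * X]mulrA EC.
by rewrite -!mulrA [sigma Q W * _]mulrC.
Qed.

(** Source levels beyond j contribute nothing at level j, so one J can replace the stop at the level
    of W. The first J levels of the reassembled series thus become a square double sum, ready for
    exchange. *)
Lemma lsum_reassemble c sigma j J x : cell_supported sigma -> (j < J)%N ->
  L s (reassemble c sigma) j x = \sum_(0 <= k < J) L s (relevel c k sigma) j x.
Proof.
move=> ss jJ.
rewrite (eq_lsum gP p s (c' := fun W => \sum_(0 <= k < J) relevel c k sigma W)).
  exact: lsum_sum.
move=> W PW; rewrite (reassembleE c sigma PW) [RHS](@big_cat_nat _ _ _ j.+1)//=.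
rewrite [X in _ = _ + X]big_nat [X in _ = _ + X]big1 ?addr0// => k /andP[jk _].
exact: (relevel_coarse c ss jk PW).
Qed.

Lemma mul_lsum c k (g : T -> R[i]) x :
  g x * L s c k x =
  \sum_(Q <- cells P k) (c Q * ((vol Q `^ (s - beta))%:C)%C) *
    (g x * canonical_atom m beta p Q x).
Proof.
rewrite lsumE// mulr_sumr; apply: eq_big_seq => Q /(cellsP fP) PQ.
have vQ := cell_vol_gt0 gP PQ.
have [Qx|nQx] := pselect (Q x); last by rewrite !canonical_atom_out// !mulr0.
rewrite !canonical_atom_in//.
have -> : vol Q `^ (s - p^-1) = vol Q `^ (s - beta) * vol Q `^ (beta - p^-1).
  rewrite -powRD; last by apply/implyP => _; rewrite gt_eqF.
  by rewrite addrA subrK.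
rewrite rmorphM/= mulrCA -!mulrA; congr (_ * _).
by rewrite mulrCA.
Qed.

End reassembly.

(** * The product of f with one multiplier *)

Section product_expansion.
Context {R : realType} {d : measure_display} {T : measurableType d}.
Variables (m : {finite_measure set T -> \bar R}) (P : nat -> set (set T)).
Hypothesis gP : good_grid m P.
Variable p : R.
Hypothesis p1 : 1 <= p.
Let p0 : 0 < p. Proof. exact: lt_le_trans p1. Qed.
Variables l2 s beta : R.
Hypotheses (l20 : 0 < l2) (l21 : l2 < 1) (s0 : 0 < s) (sb : s < beta).
Local Notation vol := (vol m).
Hypothesis ratio_hi : forall k Q Q', P k.+1 Q -> P k Q' -> Q `<=` Q' ->
  vol Q <= l2 * vol Q'.
Let fP := grid_finite gP.
Local Notation N := (LpNorm m p).
Local Notation L := (lsum m P p).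
Local Notation th := (l2 `^ (beta - s)).
Local Notation mu := (l2 `^ s).

Let th0 : 0 <= th. Proof. exact: powR_ge0. Qed.
Let th1 : th < 1. Proof. by apply: decay_lt1 => //; rewrite subr_gt0. Qed.
Let mu0 : 0 <= mu. Proof. exact: powR_ge0. Qed.
Let mu1 : mu < 1. Proof. exact: decay_lt1. Qed.
Let mL b c j : measurable_complex (L b c j).
Proof. exact: measurable_lsum. Qed.

Variables (f g : T -> R[i]) (c : set T -> R[i]) (sigma : set T -> set T -> R[i]).
Variables (B X : R).
Hypotheses (mf : measurable_complex f) (mg : measurable_complex g).
Hypothesis fL : Lp_cvg m p (fun n x => \sum_(0 <= k < n) L s c k x) f.
Hypothesis cX : forall k, lnorm P p c k <= X.
Hypothesis ss : cell_supported sigma.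
Hypothesis B0 : 0 <= B.
Hypothesis sB : forall Q j, lnorm P p (sigma Q) j <= B.
Hypothesis gs : forall k Q, P k Q -> c Q != 0 ->
  Lp_cvg m p (fun n x => \sum_(0 <= j < n) L beta (sigma Q) j x)
    (fun x => g x * canonical_atom m beta p Q x).

Let X0 : 0 <= X. Proof. by apply: le_trans (cX 0%N); exact: lnorm_ge0. Qed.

Let D := vol setT `^ s * (B * X).
Let D0 : 0 <= D. Proof. by rewrite !mulr_ge0 ?powR_ge0. Qed.

Lemma level_product_cvg k :
  Lp_cvg m p (fun n x => \sum_(0 <= j < n) L s (relevel m P s beta c k sigma) j x)
    (fun x => g x * L s c k x).
Proof.
pose z Q : R[i] := c Q * ((vol Q `^ (s - beta))%:C)%C.
have mS Q n : measurable_complex (fun x => \sum_(0 <= j < n) L beta (sigma Q) j x).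
  by apply: measurable_complex_sum.
have mgQ Q : Q \in cells P k ->
    measurable_complex (fun x => g x * canonical_atom m beta p Q x).
  move=> /(cellsP fP) PQ; apply: measurable_complexM => //.
  exact: (measurable_canonical_atom gP p beta PQ).
have := @Lp_cvg_sum _ _ _ m p p1 _ (cells P k)
  (fun Q n x => z Q * \sum_(0 <= j < n) L beta (sigma Q) j x)
  (fun Q x => z Q * (g x * canonical_atom m beta p Q x)).
move=> H; apply: eq_Lp_cvg (H _ _ _).
- by move=> x; rewrite (mul_lsum gP p s beta).
- exists 0%N => n x _; under [RHS]eq_bigr do rewrite (lsum_relevel gP)//.
  by rewrite exchange_big/=; apply: eq_bigr => Q _; rewrite mulr_sumr.
- by move=> Q n _; exact: (measurable_complexM (measurable_complex_cst _) (mS Q n)).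
- by move=> Q /mgQ mQ; exact: (measurable_complexM (measurable_complex_cst _) mQ).
move=> Q QE; have PQ := cellsP fP _ _ QE.
have [cQ|cQ] := eqVneq (c Q) 0.
  apply: eq_Lp_cvg (Lp_cvg_cst m p1 (fun=> 0)).
    by move=> x; rewrite /z cQ !mul0r.
  by exists 0%N => n x _; rewrite /z cQ !mul0r.
apply: Lp_cvgZ => //; first exact: mgQ.
exact: gs PQ cQ.
Qed.

(** Two decays cooperate: mu^j because the cells of level j are small, th^(j - k) because of the
    excess smoothness beta - s over the depth below level k. *)
Lemma LpNorm_relevel k j : (k <= j)%N ->
  (N (L s (relevel m P s beta c k sigma) j) <= (D * mu ^+ j * th ^+ (j - k))%:E)%E.
Proof.
move=> kj; apply: le_trans (LpNorm_lsum_level gP p1 l20 ratio_hi _ _ (ltW s0)) _.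
rewrite lee_fin [leRHS]mulrAC ler_wpM2r ?exprn_ge0// /D -mulrA ler_wpM2l ?powR_ge0//.
apply: le_trans (lnorm_relevel gP p1 l20 sb ratio_hi c ss B0 sB kj) _.
by rewrite mulrC ler_wpM2r ?exprn_ge0// ler_wpM2l.
Qed.

Lemma level_product_tail k J : (k <= J)%N ->
  (N (fun x => g x * L s c k x -
      \sum_(0 <= j < J) L s (relevel m P s beta c k sigma) j x)%R <=
   (D * mu ^+ J * th ^+ (J - k) / (1 - mu))%:E)%E.
Proof.
move=> kJ; have D'0 : 0 <= D * mu ^+ J * th ^+ (J - k).
  by apply: mulr_ge0; [apply: mulr_ge0 D0 _|]; exact: exprn_ge0.
have := @Lp_tail _ _ _ m p p1 (L s (relevel m P s beta c k sigma))
  (fun x => g x * L s c k x) (fun=> 1) J _ mu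
  (measurable_complexM mg (mL _ _ _)) (measurable_complex_cst 1)
  (fun j => mL _ _ _) D'0 mu0 mu1 (level_product_cvg k).
move=> H; apply: le_trans (H _).
  rewrite le_eqVlt; apply/orP; left; apply/eqP; apply: eq_LpNorm => x.
  by rewrite mul1r; congr (_ - _); apply: eq_bigr => j _; rewrite mul1r.
move=> j; rewrite (eq_LpNorm m p (v := L s (relevel m P s beta c k sigma) (j + J)%N)).
  apply: le_trans (LpNorm_relevel _) _; first by rewrite (leq_trans kJ)// leq_addl.
  rewrite lee_fin [leRHS]mulrAC [(j + J)%N]addnC exprD mulrA.
  apply: ler_wpM2l; first by apply: mulr_ge0; [apply: mulr_ge0 D0 _|]; exact: exprn_ge0.
  by apply: ler_wiXn2l => //; [exact: ltW|exact/leq_sub2r/leq_addr].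
by move=> x; rewrite mul1r.
Qed.

(** The error splits into [g] times the source levels from J on, and the parts of target level at
    least J coming from the first J source levels. Both are O(mu^J), and they give the two summands
    of [E]. *)
Lemma product_cvg :
  Lp_cvg m p (fun n x => \sum_(0 <= j < n) L s (reassemble m P s beta c sigma) j x)
    (fun x => g x * f x).
Proof.
have imu : 0 < 1 - mu by rewrite subr_gt0.
have ith : 0 < 1 - th by rewrite subr_gt0.
pose E := D / (1 - mu) / (1 - mu) + D / (1 - mu) / (1 - th).
apply: (geometric_cvg0 (B := E) mu0 mu1) => [J|J]; first exact: LpNorm_ge0.
have D'0 : 0 <= D / (1 - mu) * mu ^+ J by apply: mulr_ge0; [exact: divr_ge0 D0 (ltW imu)|exact: exprn_ge0].
have mS k : measurable_complex
    (fun x => \sum_(0 <= j < J) L s (relevel m P s beta c k sigma) j x).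
  exact: measurable_complex_sum.
have mgf : measurable_complex (fun x => g x * f x) by exact: measurable_complexM.
have mgl k : measurable_complex (fun x => g x * L s c k x).
  exact: measurable_complexM.
have mgS : measurable_complex (fun x => \sum_(0 <= k < J) g x * L s c k x).
  exact: measurable_complex_sum.
rewrite (eq_LpNorm m p (v := fun x =>
  (g x * f x - \sum_(0 <= k < J) g x * L s c k x) +
  \sum_(0 <= k < J) (g x * L s c k x -
    \sum_(0 <= j < J) L s (relevel m P s beta c k sigma) j x))); last first.
  move=> x; rewrite sumrB addrA subrK; congr (_ - _).
  rewrite exchange_big/= !big_nat; apply: eq_bigr => j /andP[_ jJ].
  exact: (lsum_reassemble gP p s beta l20 l21 ratio_hi c x ss jJ).
apply: le_trans (LpNormD _ p1 _ _) _.
- exact: measurable_complexB.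
- by apply: measurable_complex_sum => k _; exact: measurable_complexB.
rewrite /E mulrDl EFinD; apply: leeD.
  have := @Lp_tail _ _ _ m p p1 (L s c) f g J _ mu mf mg (fun k => mL _ _ _) D'0
    mu0 mu1 fL.
  move=> H; apply: le_trans (H _) _ => [k|]; last by rewrite lee_fin mulrAC.
  (* The expansion of [g] times the source level k + J has no coarser coefficient, so cutting it at
     that level removes nothing: the tail estimate bounds the whole product. *)
  have := level_product_tail (leqnn (k + J)%N); rewrite subnn expr0 mulr1.
  rewrite (eq_LpNorm m p (v := fun x => g x * L s c (k + J)%N x)); last first.
    move=> x; rewrite big_nat big1 ?subr0// => j /andP[_ jk].
    apply: (lsum_eq0 gP) => W PW.
    exact: (relevel_coarse gP s beta l20 l21 ratio_hi c ss jk PW).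
  move=> /le_trans; apply.
  by rewrite lee_fin addnC exprD mulrA mulrAC [X in X * _ <= _]mulrAC.
apply: le_trans (LpNorm_sum_dom _ p1 _ _ _) _.
- by apply: measurable_complex_sum => k _; exact: measurable_complexB.
- by move=> k; exact: (measurable_complexB (mgl k) (mS k)).
- by move=> x; exact: normc_sum.
(* One factor th is given up so that, after reversal, the exponents run from 0 to J - 1. *)
apply: (@le_trans _ _ (\sum_(0 <= k < J) (D / (1 - mu) * mu ^+ J * th ^+ (J - k.+1))%:E)%E).
  rewrite !big_nat; apply: lee_sum => k /andP[_ kJ].
  apply: le_trans (level_product_tail (ltnW kJ)) _.
  rewrite lee_fin mulrAC [X in X * _ <= _]mulrAC; apply: ler_wpM2l => //.
  by apply: ler_wiXn2l => //; [exact: ltW|exact: leq_sub2l].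
rewrite sumEFin lee_fin -mulr_sumr [leRHS]mulrAC; apply: ler_wpM2l => //.
rewrite big_mkord (reindex_inj rev_ord_inj)/=.
under eq_bigr => k _ do rewrite subnSK// subKn 1?ltnW//.
exact: sum_expr_le.
Qed.

End product_expansion.

Lemma cvg_sum0 (R : realType) (I : eqType) (r : seq I) (u : I -> nat -> R) :
  (forall i, i \in r -> u i @ \oo --> 0) ->
  (fun n => \sum_(i <- r) u i n) @ \oo --> 0.
Proof.
elim: r => [|i r IH] u0.
  by under eq_fun do rewrite big_nil; exact: cvg_cst.
under eq_fun do rewrite big_cons.
have h1 := u0 i (mem_head _ _).
have h2 := IH (fun j jr => u0 j (@mem_behead _ (i :: r) j jr)).
by have := cvgD h1 h2; rewrite addr0; exact.
Qed.

Lemma cvg_mul0 (R : realType) (k : R) (u : nat -> R) :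
  u @ \oo --> 0 -> (fun n => k * u n) @ \oo --> 0.
Proof. by move=> u0; have := cvgM (@cvg_cst _ k _ _ _) u0; rewrite mulr0; exact. Qed.

(** * The sum over all multipliers *)

Section sum_of_products.
Context {R : realType} {d : measure_display} {T : measurableType d}.
Variables (m : {finite_measure set T -> \bar R}) (P : nat -> set (set T)).
Hypothesis gP : good_grid m P.
Variable p : R.
Hypothesis p1 : 1 <= p.
Let p0 : 0 < p. Proof. exact: lt_le_trans p1. Qed.
Variables l2 s beta : R.
Hypotheses (l20 : 0 < l2) (l21 : l2 < 1) (s0 : 0 < s) (sb : s < beta).
Local Notation vol := (vol m).
Hypothesis ratio_hi : forall k Q Q', P k.+1 Q -> P k Q' -> Q `<=` Q' ->
  vol Q <= l2 * vol Q'.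
Let fP := grid_finite gP.
Local Notation N := (LpNorm m p).
Local Notation L := (lsum m P p).
Local Notation th := (l2 `^ (beta - s)).
Local Notation mu := (l2 `^ s).
Local Notation E := (reassemble m P s beta).

Let th0 : 0 <= th. Proof. exact: powR_ge0. Qed.
Let th1 : th < 1. Proof. by apply: decay_lt1 => //; rewrite subr_gt0. Qed.
Let mu0 : 0 <= mu. Proof. exact: powR_ge0. Qed.
Let mu1 : mu < 1. Proof. exact: decay_lt1. Qed.
Let mL b c j : measurable_complex (L b c j).
Proof. exact: measurable_lsum. Qed.

Variables (Lambda : set nat) (f : T -> R[i]) (g : nat -> T -> R[i])
  (c : set T -> R[i]) (S : nat -> set T -> set T -> R[i]).
Variables (b : nat -> set T -> R) (B X : R).
Hypotheses (mf : measurable_complex f)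
  (mg : forall i, Lambda i -> measurable_complex (g i)).
Hypothesis fL : Lp_cvg m p (fun n x => \sum_(0 <= k < n) L s c k x) f.
Hypothesis cX : forall k, lnorm P p c k <= X.
Hypothesis S1 : forall i, cell_supported (S i).
Hypothesis S0 : forall i, ~ Lambda i -> forall Q W, S i Q W = 0.
Hypothesis Sb : forall i Q j, lnorm P p (S i Q) j <= b i Q.
Hypothesis bB : forall Q n, \sum_(0 <= i < n) b i Q <= B.
Hypothesis gS : forall i k Q, Lambda i -> P k Q -> c Q != 0 ->
  Lp_cvg m p (fun n x => \sum_(0 <= j < n) L beta (S i Q) j x)
    (fun x => g i x * canonical_atom m beta p Q x).

Let X0 : 0 <= X. Proof. by apply: le_trans (cX 0%N); exact: lnorm_ge0. Qed.
Let b0 i Q : 0 <= b i Q.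
Proof. by apply: le_trans (Sb i Q 0%N); exact: lnorm_ge0. Qed.
Let B0 : 0 <= B. Proof. by have := bB setT 0%N; rewrite big_geq. Qed.

Let sigma n Q W := \sum_(0 <= i < n) S i Q W.
(** The limit of [sigma n], taken coefficient by coefficient. The guard makes the support condition
    immediate for every set W. *)
Let tau Q W := if `[< W `<=` Q >] then csum (fun i => S i Q W) else 0.

Let sigma_supported n : cell_supported (sigma n).
Proof.
move=> Q W; apply: contraPP => WQ; rewrite /sigma big1 ?eqxx// => i _.
by apply/eqP/negPn/negP => /S1.
Qed.

Let tau_supported : cell_supported tau.
Proof. by move=> Q W; rewrite /tau; case: asboolP => // _; rewrite eqxx. Qed.

Let sigmaB n Q j : lnorm P p (sigma n Q) j <= B.
Proof.
apply: le_trans (bB Q n).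
apply: (@le_trans _ _ (lpn (cells P j) p (fun W => \sum_(0 <= i < n) normc (S i Q W)))).
  by apply: le_lpn => // W _; rewrite normc_ge0 normc_sum.
apply: le_trans (lpn_sum _ _ _) _ => //; first by move=> i W _; exact: normc_ge0.
by apply: ler_sum => i _; exact: Sb.
Qed.

Let SB i Q j : lnorm P p (S i Q) j <= B.
Proof.
apply: le_trans (Sb i Q j) _; apply: le_trans (bB Q i.+1).
by rewrite big_nat_recr//= lerDr sumr_ge0.
Qed.

Let S_bounded Q j W : P j W -> abs_bounded (fun i => S i Q W).
Proof.
move=> PW; exists B => n; apply: le_trans (bB Q n); apply: ler_sum => i _.
apply: le_trans (Sb i Q j).
apply: (coord_le_lpn (x := fun W => normc (S i Q W))) => //; last exact: normc_ge0.
exact/cellsP.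
Qed.

Let sigma_cvg Q j W : P j W ->
  (fun n => normc (tau Q W - sigma n Q W)) @ \oo --> 0.
Proof.
move=> PW; rewrite /tau /sigma; case: asboolP => WQ.
  exact: (csum_cvg (S_bounded Q PW)).
have Z i : S i Q W = 0 by apply/eqP/negPn/negP => /S1.
under eq_fun => n do rewrite big1 ?subrr ?normc0//.
exact: cvg_cst.
Qed.

(** A level has finitely many cells, so [sigma n] tends to [tau] in level norm, and the bound [B]
    passes to the limit. *)
Let tauB Q j : lnorm P p (tau Q) j <= B.
Proof.
have H : (fun n => lpn (cells P j) p (fun W => normc (tau Q W - sigma n Q W))) @ \oo --> 0.
  apply: (lpn_cvg0 p0) => [n W|W /(cellsP fP) PW]; first exact: normc_ge0.
  exact: (sigma_cvg Q PW).
have {}H : (fun n => B + lpn (cells P j) p (fun W => normc (tau Q W - sigma n Q W)))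
    @ \oo --> B.
  by have := cvgD (@cvg_cst _ B _ _ _) H; rewrite addr0; exact.
rewrite -(cvg_lim (@Rhausdorff R) H).
apply: limr_ge; first by apply/cvg_ex; eexists; exact: H.
apply: nearW => n /=.
apply: le_trans (lerD (sigmaB n Q j) (lexx _)).
apply: (@le_trans _ _ (lpn (cells P j) p
    (fun W => normc (sigma n Q W) + normc (tau Q W - sigma n Q W)))); last first.
  by apply: lpnD => // W _; exact: normc_ge0.
apply: le_lpn => // W _; rewrite normc_ge0/=.
by apply: le_trans (normcD _ _); rewrite subrKC.
Qed.

Let reassemble_cvg j W : P j W ->
  (fun n => normc (E c tau W - E c (sigma n) W)) @ \oo --> 0.
Proof.
move=> PW.
pose u n := \sum_(k <- index_iota 0 j.+1) \sum_(Q <- cells P k)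
  (normc (c Q) * reweight m s beta Q W) * normc (tau Q W - sigma n Q W).
have uc : u @ \oo --> 0.
  apply: cvg_sum0 => k _; apply: cvg_sum0 => Q _; apply: cvg_mul0.
  exact: (sigma_cvg Q PW).
apply: squeeze_cvgr; [|exact: (@cvg_cst _ (0:R))|exact: uc].
apply: nearW => n; rewrite normc_ge0/= -reassembleB.
rewrite (reassembleE gP s beta l20 l21 ratio_hi _ _ PW).
apply: le_trans (normc_sum _ _ _) _; apply: ler_sum => k _.
apply: le_trans (normc_sum _ _ _) _; apply: ler_sum => Q _.
by rewrite !normcM normc_real ger0_norm// powR_ge0.
Qed.

Let D := vol setT `^ s * (B * X / (1 - th)).
Let D0 : 0 <= D.
Proof. by rewrite !mulr_ge0 ?powR_ge0// invr_ge0 subr_ge0 ltW. Qed.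

(** Stated for an arbitrary family so that it serves [tau] and every [sigma n] with the same
    constant; this gives tails that are uniform in n. *)
Let level_bound sg k : cell_supported sg ->
  (forall Q j, lnorm P p (sg Q) j <= B) ->
  (N (L s (E c sg) k) <= (D * mu ^+ k)%:E)%E.
Proof.
move=> ss sB; apply: le_trans (LpNorm_lsum_level gP p1 l20 ratio_hi _ _ (ltW s0)) _.
rewrite lee_fin; apply: ler_wpM2r; first exact: exprn_ge0.
apply: ler_wpM2l; first exact: powR_ge0.
exact: (lnorm_reassemble_bounded gP p1 l20 l21 sb ratio_hi k ss B0 sB cX).
Qed.

Let G n x := \sum_(0 <= i < n | i \in Lambda) g i x * f x.

Let mG n : measurable_complex (G n).
Proof.
apply: measurable_complex_sum => i /set_mem Li.
by apply: measurable_complexM => //; exact: mg.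
Qed.

Let G_cvg n :
  Lp_cvg m p (fun J x => \sum_(0 <= j < J) L s (E c (sigma n)) j x) (G n).
Proof.
pose r := [seq i <- index_iota 0 n | i \in Lambda].
have rL i : i \in r -> Lambda i by rewrite mem_filter => /andP[/set_mem].
have := @Lp_cvg_sum _ _ _ m p p1 _ r
  (fun i J x => \sum_(0 <= j < J) L s (E c (S i)) j x) (fun i x => g i x * f x).
move=> H; apply: eq_Lp_cvg (H _ _ _).
- by move=> x; rewrite /r big_filter.
- exists 0%N => J x _; rewrite exchange_big/=; apply: eq_bigr => j _.
  rewrite [RHS](eq_lsum gP p s (c' := fun W => \sum_(0 <= i < n) E c (S i) W)).
    rewrite lsum_sum// /r big_filter [RHS](bigID (fun i => i \in Lambda))/=.
    rewrite [X in _ = _ + X]big1 ?addr0// => i /negP iL.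
    apply: (lsum_eq0 gP) => W PW; rewrite /reassemble big1// => k _.
    by rewrite /relevel big1// => Q _; rewrite S0 ?mulr0// => /mem_set.
  by move=> W PW; rewrite /sigma reassemble_sum.
- by move=> i J _; exact: measurable_complex_sum.
- by move=> i /rL Li; apply: measurable_complexM => //; exact: mg.
move=> i /rL Li.
apply: (product_cvg gP p1 l20 l21 s0 sb ratio_hi mf (mg Li) fL cX (S1 (i := i)) B0 (SB i)).
by move=> k Q PQ cQ; exact: (gS Li PQ cQ).
Qed.

(** The function [h] is obtained by completeness from the coefficients [tau]. Its distance to the
    n-th partial sum is split at a level J: two tails controlled by mu^J alone, and a head of
    finitely many coefficients that converge as n grows. Hence J is fixed before n. *)
Lemma sum_of_products : exists (h : T -> R[i]) (e : set T -> R[i]),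
  [/\ is_sum_times m p Lambda g f h, Lp m p h,
      (\sum_(0 <= k <oo) N (L s e k) < +oo)%E,
      Lp_cvg m p (fun n x => \sum_(0 <= k < n) L s e k x) h &
      forall j, lnorm P p e j <=
        B * \sum_(l < j.+1) th ^+ l * lnorm P p c (j - l)%N].
Proof.
have imu : 0 < 1 - mu by rewrite subr_gt0.
have tb k := level_bound k tau_supported tauB.
have [h mh hL] := Lp_geometric_complete p1 (fun k => mL s (E c tau) k) D0 mu0 mu1 tb.
have hcvg : Lp_cvg m p (fun n x => \sum_(0 <= k < n) L s (E c tau) k x) h.
  apply: (geometric_cvg0 (B := 2 * D / (1 - mu)) mu0 mu1) => [n|n].
    exact: LpNorm_ge0.
  by apply: le_trans (hL n) _; rewrite lee_fin mulrAC.
exists h, (E c tau); split=> //; last 3 first.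
- split=> //; apply: (@le_lt_trans _ _ (2 * D * mu ^+ 0 / (1 - mu))%:E); last exact: ltry.
  apply: le_trans (hL 0%N); rewrite (eq_LpNorm m p (v := h))// => x.
  by rewrite big_geq// subr0.
- apply: (@le_lt_trans _ _ (D / (1 - mu))%:E); last exact: ltry.
  by apply: nneseries_geometric_le => // k; exact: LpNorm_ge0.
- by move=> j; exact: (lnorm_reassemble gP p1 l20 l21 sb ratio_hi c j tau_supported B0 tauB).
apply/ereal_cvg0P => [n|e e0]; first exact: LpNorm_ge0.
have e20 : 0 < e / 2 by rewrite divr_gt0.
(* In the 3, a 2 comes from the rate in [Lp_geometric_complete] and a 1 from the tail of [G n]. *)
have gJ : (fun J => (3 * D / (1 - mu)) * mu ^+ J) @ \oo --> 0.
  have := cvg_geometric (3 * D / (1 - mu)) (z := mu); rewrite ger0_norm//; exact.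
have /cvgrPdist_le/(_ _ e20)[J _ /(_ J (leqnn J))] := gJ.
rewrite /= sub0r normrN ger0_norm; last first.
  rewrite mulr_ge0 ?exprn_ge0// divr_ge0 ?(ltW imu)//.
  exact: mulr_ge0.
move=> HJ.
pose delta n j := lpn (cells P j) p (fun W => normc (E c tau W - E c (sigma n) W)).
have dc : (fun n => \sum_(j <- index_iota 0 J) (vol setT `^ s * mu ^+ j) * delta n j) @ \oo --> 0.
  apply: cvg_sum0 => j _; apply: cvg_mul0.
  apply: (lpn_cvg0 p0) => [n W|W /(cellsP fP) PW]; first exact: normc_ge0.
  exact: (reassemble_cvg PW).
have /cvgrPdist_le/(_ _ e20)[K _ HK] := dc.
exists K => n Kn; have := HK n Kn; rewrite /= sub0r normrN ger0_norm; last first.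
  apply: sumr_ge0 => j _; rewrite mulr_ge0 ?lpn_ge0//.
  by apply: mulr_ge0; [exact: powR_ge0|exact: exprn_ge0].
move=> {}HK.
have mS c' : measurable_complex (fun x => \sum_(0 <= j < J) L s c' j x).
  exact: measurable_complex_sum.
(* The three pieces: tail of [h], difference of the heads, tail of [G n]. *)
pose v (o : option bool) x : R[i] := match o with
  | None => h x - \sum_(0 <= j < J) L s (E c tau) j x
  | Some true => \sum_(0 <= j < J) L s (fun W => E c tau W - E c (sigma n) W) j x
  | Some false => G n x - \sum_(0 <= j < J) L s (E c (sigma n)) j x
  end.
apply: (@le_trans _ _ (\sum_(o <- [:: None; Some true; Some false]) N (v o))%E).
  apply: (LpNorm_sum_dom m p1).
  - exact: (measurable_complexB mh (mG n)).
  - case=> [[]|]; first exact: mS.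
      exact: measurable_complexB (mG n) (mS _).
    exact: measurable_complexB mh (mS _).
  move=> x; rewrite !big_cons big_nil addr0 /v.
  under [X in _ + (normc X + _)]eq_bigr do rewrite lsumB//.
  rewrite sumrB -[normc (G n x - _)]normcN opprB.
  set a1 := \sum_(0 <= j < J) _; set a2 := \sum_(0 <= j < J) _.
  apply: le_trans (lerD (lexx _) (normcD _ _)); apply: le_trans (normcD _ _).
  by rewrite !addrA !subrK.
rewrite !big_cons big_nil adde0.
have -> : e = e / 2 + e / 2 by rewrite -splitr.
rewrite EFinD addeCA; apply: leeD.
  apply: le_trans (LpNorm_sum_dom m p1 _ (fun j => mL s _ j) (fun x => normc_sum _ _ _)) _.
    exact: mS.
  apply: le_trans (_ : ((\sum_(j <- index_iota 0 J) vol setT `^ s * mu ^+ j * delta n j)%:E <= _)%E); last by rewrite lee_fin.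
  rewrite -sumEFin; apply: lee_sum => j _.
  apply: le_trans (LpNorm_lsum_level gP p1 l20 ratio_hi _ _ (ltW s0)) _.
  by rewrite lee_fin [leRHS]mulrAC.
apply: (@le_trans _ _ ((2 * D * mu ^+ J / (1 - mu))%:E + (D * mu ^+ J / (1 - mu))%:E)%E); last first.
  rewrite -EFinD lee_fin; apply: le_trans HJ.
  by rewrite le_eqVlt; apply/orP; left; apply/eqP; field; rewrite gt_eqF.
apply: leeD; first exact: hL.
have DJ : 0 <= D * mu ^+ J by apply: mulr_ge0 => //; exact: exprn_ge0.
have := @Lp_tail _ _ _ m p p1 (L s (E c (sigma n))) (G n) (fun=> 1) J _ mu
  (mG n) (measurable_complex_cst 1) (fun k => mL _ _ _) DJ mu0 mu1 (G_cvg n).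
move=> H; apply: le_trans (H _).
  rewrite le_eqVlt; apply/orP; left; apply/eqP; apply: eq_LpNorm => x.
  by rewrite /v mul1r; congr (_ - _); apply: eq_bigr => j _; rewrite mul1r.
move=> j; rewrite (eq_LpNorm m p (v := L s (E c (sigma n)) (j + J)%N)).
  apply: le_trans (level_bound _ (sigma_supported (n := n)) (sigmaB n)) _.
  by rewrite lee_fin addnC exprD mulrA.
by move=> x; rewrite mul1r.
Qed.

End sum_of_products.

(** * Nonnegativity of the norms, and the conclusion *)

Section norms_ge0.
Context {R : realType} {d : measure_display} {T : measurableType d}.
Variables (m : {finite_measure set T -> \bar R}) (P : nat -> set (set T)).
Hypothesis gP : good_grid m P.
Variable p : R.
Hypothesis p1 : 1 <= p.
Let p0 : 0 < p. Proof. exact: lt_le_trans p1. Qed.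

Lemma souza_canonical_atom s Q : souza_atom m s p Q (canonical_atom m s p Q).
Proof.
split.
- by exists ((vol m Q `^ (s - p^-1))%:C)%C => x; exact: canonical_atom_in.
- by move=> x; exact: canonical_atom_out.
move=> x; rewrite /canonical_atom normc_real ger0_norm ?mulr_ge0 ?powR_ge0//.
by rewrite ler_piMr ?powR_ge0// indicE; case: (x \in Q).
Qed.

Lemma cost_ge0 q c : (0 <= cost P p q c)%E.
Proof.
rewrite cost_lqcost//; last exact: (grid_finite gP).
by apply: lqcost_ge0 => k; exact: lnorm_ge0.
Qed.

Lemma besov_norm_ge0 s q g : (0 <= besov_norm m P s p q g)%E.
Proof.
apply: le_ereal_inf_tmp => _ [c [a [_ ->]]]; exact: cost_ge0.
Qed.

(** The supremum must not be over an empty family: level t is inhabited, since each level covers a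
    space of positive measure up to a null set. *)
Lemma selfs_norm_ge0 b q t g : (0 <= selfs_norm m P b p q t g)%E.
Proof.
have [Q PQ] : exists Q, P t Q.
  by apply: (cell_exists gP); exists setT; rewrite (grid_0 gP).
apply: le_trans (besov_norm_ge0 b q (fun x => g x * canonical_atom m b p Q x)) _.
apply: ereal_sup_ubound; exists t, Q, (canonical_atom m b p Q); split=> //.
exact: souza_canonical_atom.
Qed.

End norms_ge0.

Theorem proposition18p4 (R : realType) (d : measure_display)
    (T : measurableType d) (m : {finite_measure set T -> \bar R})
    (P : nat -> set (set T)) (p : R) (q qt : \bar R) (s beta : R) :
  good_grid m P ->
  1 <= p -> (1 <= q)%E -> (1 <= qt)%E ->
  0 < s -> s < p^-1 -> s < beta ->
  exists C : R,
    forall (Lambda : set nat) (t : nat -> nat) (g : nat -> T -> R[i])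
      (f : T -> R[i]) (c : set T -> R[i]) (a : set T -> T -> R[i]) (N : R),
    (forall i, Lambda i -> selfs m P beta p qt (t i) (g i)) ->
    representation m P s p q f c a ->
    (ereal_sup [set v | exists Q, [/\ (\bigcup_k P k) Q, (c Q != 0)%R &
        v = \esum_(i in [set i | Lambda i /\ Q `&` supp (g i) !=set0])
              selfs_norm m P beta p qt (t i) (g i)]] <= N%:E)%E ->
    (forall k Q i, P k Q -> c Q != 0 -> Lambda i ->
        Q `&` supp (g i) !=set0 -> (t i <= k)%N) ->
    exists (h : T -> R[i]) (e : set T -> R[i]),
      [/\ is_sum_times m p Lambda g f h,
          representation m P s p q h e (canonical_atom m s p) &
          (cost P p q e <= C%:E * N%:E * cost P p q c)%E].
Proof.
move=> gP p1 q1 qt1 s0 _ sb.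
have p0 : 0 < p by exact: lt_le_trans p1.
have fP := grid_finite gP.
have b0 : 0 < beta by exact: lt_trans sb.
have [l1 [l2 [l10 l12 l21 ratio]]] := grid_ratio gP.
have l20 : 0 < l2 by exact: lt_trans l12.
have ratio_lo k Q Q' : P k.+1 Q -> P k Q' -> Q `<=` Q' -> l1 * vol m Q' <= vol m Q.
  move=> PQ PQ' QQ'; have v0 := cell_vol_gt0 gP PQ'.
  by have /andP[+ _] := ratio k Q Q' PQ PQ' QQ'; rewrite ler_pdivlMr.
have ratio_hi k Q Q' : P k.+1 Q -> P k Q' -> Q `<=` Q' -> vol m Q <= l2 * vol m Q'.
  move=> PQ PQ' QQ'; have v0 := cell_vol_gt0 gP PQ'.
  by have /andP[_] := ratio k Q Q' PQ PQ' QQ'; rewrite ler_pdivrMr.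
pose K := 2 * local_const p l1 l2 beta.
have K0 : 0 <= K.
  have := local_const_ge1 p l1 l20 l21 b0.
  by move=> /(le_trans ler01) lc0; rewrite /K mulr_ge0.
pose th := l2 `^ (beta - s).
have th0 : 0 <= th by exact: powR_ge0.
have th1 : th < 1 by apply: decay_lt1 => //; rewrite subr_gt0.
exists (K / (1 - th)) => Lambda t g f c a N gself rep supN lev.
have [c' [c'c c'X fL]] := repr_canonical gP p1 q1 rep.
(* Hypotheses A and B concern the original coefficients, while the expansions use the canonical
   ones. *)
have c'0 Q : c' Q != 0 -> c Q != 0.
  apply: contra => /eqP cQ; rewrite -normc_eq0 eq_le normc_ge0 andbT.
  by have := c'c Q; rewrite cQ normc0.
have [mf _] := repr_Lp rep.
have mg i : Lambda i -> measurable_complex (g i).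
  by move=> /gself[[? [? /repr_Lp[]]]].
pose M i := fine (selfs_norm m P beta p qt (t i) (g i)).
have M0 i : 0 <= M i by rewrite fine_ge0// (selfs_norm_ge0 gP p1).
have ME i : Lambda i -> selfs_norm m P beta p qt (t i) (g i) = (M i)%:E.
  by move=> /gself[_ fin]; rewrite fineK// ge0_fin_numE// (selfs_norm_ge0 gP p1).
have supNQ k Q : P k Q -> c Q != 0 ->
    (\esum_(i in [set i | Lambda i /\ Q `&` supp (g i) !=set0])
      selfs_norm m P beta p qt (t i) (g i) <= N%:E)%E.
  move=> PQ cQ; apply: le_trans supN; apply: ereal_sup_ubound.
  by exists Q; split=> //; exists k.
(* For the pairs in [rel] the selfs norm provides an expansion. For a cell with nonzero [c'] and an
   [i] in [Lambda] outside [rel], Q misses the support of [g i] and the product vanishes. Giving all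
   pairs outside [rel] the bound 0 makes the sums of [b] controllable for every set Q. *)
pose rel i Q := [/\ Lambda i, c' Q != 0, exists k, P k Q &
  Q `&` supp (g i) !=set0].
pose b i Q := if `[< rel i Q >] then K * M i else 0.
(* Nothing excludes a negative [N]; the summation lemmas need a nonnegative bound. *)
pose A := Num.max N 0.
have A0 : 0 <= A by rewrite le_max lexx orbT.
have bB Q n : \sum_(0 <= i < n) b i Q <= K * A.
  have [[k [PQ cQ]]|nQ] := pselect (exists k, P k Q /\ c' Q != 0); last first.
    rewrite big1 ?(mulr_ge0 K0 A0)// => i _; rewrite /b; case: asboolP => // -[_ cQ [k PQ] _].
    by exfalso; apply: nQ; exists k.
  pose near i := `[< Lambda i /\ Q `&` supp (g i) !=set0 >].
  apply: (@le_trans _ _ (K * \sum_(0 <= i < n | near i) M i)).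
    rewrite [X in K * X]big_mkcond/= mulr_sumr; apply: ler_sum => i _.
    rewrite /b /near; case: asboolP => [[Li _ _ QS]|_].
      by rewrite asboolT.
    by case: ifP => _; rewrite ?mulr0// (mulr_ge0 K0 (M0 i)).
  rewrite ler_wpM2l// le_max; apply/orP; left.
  rewrite -lee_fin; apply: le_trans (supNQ k Q PQ (c'0 _ cQ)).
  have -> : [set i | Lambda i /\ Q `&` supp (g i) !=set0] = [set i | near i].
    by apply/seteqP; split => i /asboolP.
  rewrite -nneseries_esum; last by move=> i _; exact: (selfs_norm_ge0 gP p1).
  rewrite -sumEFin.
  rewrite (eq_bigr (fun i => selfs_norm m P beta p qt (t i) (g i))); last first.
    by move=> i /asboolP[Li _]; rewrite ME.
  by apply: nneseries_lim_ge => i _ _; exact: (selfs_norm_ge0 gP p1).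
have /choice[S SP] : forall iQ : nat * set T, exists y : set T -> R[i],
  [/\ forall W, y W != 0 -> W `<=` iQ.2,
      forall j, lnorm P p y j <= b iQ.1 iQ.2,
      ~ Lambda iQ.1 -> forall W, y W = 0 &
      forall k, Lambda iQ.1 -> P k iQ.2 -> c' iQ.2 != 0 ->
      Lp_cvg m p (fun n x => \sum_(0 <= j < n) lsum m P p beta y j x)
        (fun x => g iQ.1 x * canonical_atom m beta p iQ.2 x)].
  move=> [i Q]/=; have [r|nr] := pselect (rel i Q).
    have [Li cQ [k PQ] QS] := r.
    have [||y [y1 y2 y3]] := besov_norm_local gP p1 l10 l20 l21 ratio_lo ratio_hi
      b0 (u := fun x => g i x * canonical_atom m beta p Q x) qt1 (M0 i) PQ.
    - by move=> x nQx; rewrite canonical_atom_out ?mulr0.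
    - rewrite -ME//; apply: ereal_sup_ubound.
      (* Hypothesis B puts the level of Q in the range of the supremum that defines the selfs
         norm. *)
      exists k, Q, (canonical_atom m beta p Q); split => //.
        exact: (lev k Q i PQ (c'0 _ cQ) Li QS).
      exact: souza_canonical_atom.
    by exists y; split=> // j; rewrite /b asboolT.
  exists (fun=> 0); split=> //.
  - by move=> W; rewrite eqxx.
  - move=> j; rewrite /lnorm; under eq_lpn => W _ do rewrite normc0.
    rewrite lpn0// /b; case: ifP => // _; exact: (mulr_ge0 K0 (M0 i)).
  move=> k Li PQ cQ; apply: eq_Lp_cvg (Lp_cvg_cst m p1 (fun=> 0)).
    move=> x; have [Qx|nQx] := pselect (Q x); last first.
      by rewrite canonical_atom_out ?mulr0.
    have [->|gx] := eqVneq (g i x) 0; first by rewrite mul0r.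
    by exfalso; apply: nr; split=> //; [exists k|exists x].
  by exists 0%N => n x _; rewrite big1// => j _; rewrite (lsum_eq0 gP).
have costE e' : cost P p q e' = lqcost q (lnorm P p e') by exact: cost_lqcost.
have costfin : cost P p q c \is a fin_num.
  by rewrite ge0_fin_numE ?(repr_cost rep)// (cost_ge0 gP p1).
have cX k : lnorm P p c' k <= fine (cost P p q c).
  by rewrite -lee_fin fineK//; exact: c'X.
pose S' i Q := S (i, Q).
have S1 i : cell_supported (S' i) by move=> Q; have [] := SP (i, Q).
have S0 i : ~ Lambda i -> forall Q W, S' i Q W = 0.
  by move=> Li Q; have [_ _ /(_ Li) + _] := SP (i, Q); exact.
have Sb i Q j : lnorm P p (S' i Q) j <= b i Q by have [_ + _ _] := SP (i, Q); exact.
have gS i k Q : Lambda i -> P k Q -> c' Q != 0 ->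
    Lp_cvg m p (fun n x => \sum_(0 <= j < n) lsum m P p beta (S' i Q) j x)
      (fun x => g i x * canonical_atom m beta p Q x).
  by move=> Li PQ cQ; have [_ _ _ /(_ k Li PQ cQ)] := SP (i, Q); exact.
have [h [e [hsum hLp eabs hcvg ebnd]]] := sum_of_products gP p1 l20 l21 s0 sb
  ratio_hi mf mg fL cX S1 S0 Sb bB gS.
have KA0 := mulr_ge0 K0 A0.
have ce : (cost P p q e <= (K * A / (1 - th))%:E * cost P p q c)%E.
  rewrite (costE e) (costE c); apply: (lqcost_conv q1 KA0 th0 th1
    (lnorm_ge0 P p c) (lnorm_ge0 P p e)).
    by rewrite -(costE c); exact: (repr_cost rep).
  move=> j; apply: le_trans (ebnd j) _; apply: (ler_wpM2l KA0).
  apply: ler_sum => l _; apply: ler_wpM2l; first exact: exprn_ge0.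
  by apply: le_lpn => // W _; rewrite normc_ge0 c'c.
exists h, e; split=> //.
  split=> //; first by move=> k Q _; exact: souza_canonical_atom.
  apply: le_lt_trans ce _; rewrite -(fineK costfin) -EFinM; exact: ltry.
(* If [N] is negative, a cell with nonzero coefficient would put a nonnegative sum below [N]. So [c]
   vanishes on the grid, and both costs are zero. *)
have [N0|Nneg] := leP 0 N.
  by rewrite -EFinM [K / _ * N]mulrAC -(max_l N0).
have c0 k Q : P k Q -> c Q = 0.
  move=> PQ; apply/eqP/negPn/negP => cQ.
  have := supNQ k Q PQ cQ; apply/negP; rewrite -ltNge.
  apply: (@lt_le_trans _ _ 0%E); first by rewrite lte_fin.
  by apply: esum_ge0 => i _; exact: (selfs_norm_ge0 gP p1).
have lc0 k : lnorm P p c k = 0.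
  rewrite /lnorm (eq_lpn p (y := fun=> 0)) ?lpn0// => Q /(cellsP fP) PQ.
  by rewrite (c0 k)// normc0.
have -> : cost P p q c = 0%E.
  apply/eqP; rewrite eq_le (cost_ge0 gP p1) andbT (costE c).
  apply: lqcost_le => //; first by move=> k; rewrite lc0.
    move=> r qr J; have r0 : 0 < r by rewrite (lt_le_trans ltr01)// -lee_fin -qr.
    by rewrite (eq_lpn r (y := fun=> 0)) ?lpn0// => k _; rewrite lc0.
  by move=> _ k; rewrite lc0.
have A00 : A = 0 by rewrite /A max_r// ltW.
by move: ce; rewrite A00 !mule0 mulr0 !mul0r mul0e.
Qed.
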